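(* (Main Decomposition) Let $G$ be a compact connected Hausdorff abelian group of finite dimension. Then $G\cong_t K\times T$ (topological isomorphism) where $T$ is totally factored and $K$ is clipped. In particular, $\mathrm{cHom}(\mathbb{T},K)=0$ and $\mathrm{cHom}(K,\mathbb{Q}^\vee)=0$.
   Context: All groups are abelian; $\mathbb{T}=\mathbb{R}/\mathbb{Z}$; $\mathrm{cHom}(G,H)$ is the group of continuous homomorphisms; $G^\vee=\mathrm{cHom}(G,\mathbb{T})$ is the Pontryagin dual, and $\mathbb{Q}^\vee$ is the (compact) dual of the discrete group $\mathbb{Q}$. The dimension of a compact group $G$ is $\dim_\mathbb{R}\mathrm{cHom}(\mathbb{R},G)$ (equivalently $\operatorname{rk}(\mathbb{Q}\otimes G^\vee)$). A solenoid is a connected compact group of dimension $1$. A connected compact group is totally factored if it is topologically isomorphic to a (topological) product of solenoids (the trivial group counting as the empty product). A compact group is clipped if it has no factor that is a solenoid, i.e. it is not topologically isomorphic to $\Sigma\times L$ for any solenoid $\Sigma$ and topological group $L$. *)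

(* Defs.v *)
From HB Require Import structures.
From mathcomp Require Import all_boot all_order all_algebra ring_quotient generic_quotient.
From mathcomp Require Import all_classical all_reals all_analysis.

Set Implicit Arguments.
Unset Strict Implicit.
Unset Printing Implicit Defensive.

Import Order.TTheory GRing.Theory Num.Theory numFieldTopology.Exports.
Local Open Scope classical_set_scope.
Local Open Scope ring_scope.

Definition additive_map (A B : zmodType) (f : A -> B) : Prop :=
  forall x y, f (x + y) = f x + f y.

Definition intZ (R : realType) : zmodClosed R :=
  Num.Theory.Num_int_num_subdef__canonical__Algebra_ZmodClosed R.

Definition Rtop (R : realType) : topologicalType := R.
Definition circle (R : realType) : Type :=
  @quotient_topology (Rtop R) (Quotient.quot (intZ R)).
HB.instance Definition _ (R : realType) :=
  GRing.Zmodule.on (circle R).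
HB.instance Definition _ (R : realType) :=
  Topological.on (circle R).

Definition cHom_circle_trivial (R : realType) (K : topologicalZmodType) : Prop :=
  forall f : circle R -> K, additive_map f -> continuous f -> forall x, f x = 0.

(** The dual Q^vee of the discrete group Q is the group of homomorphisms
    Q -> T, with the compact-open topology, which (Q being discrete) is the
    topology of pointwise convergence, i.e. the subspace topology inherited
    from the product {ptws rat -> circle R}.  A continuous homomorphism
    K -> Q^vee is thus a map f : K -> {ptws rat -> circle R}, continuous for
    the product topology, with values in Hom(Q, T), and additive.
    cHom(K, Q^vee) = 0 says every such map is trivial. *)
Definition cHom_Qdual_trivial (R : realType) (K : topologicalZmodType) : Prop :=
  forall f : K -> {ptws rat -> circle R},
    (forall k, additive_map (fun q : rat => f k q)) ->
    (forall k k' q, f (k + k') q = f k q + f k' q) ->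
    continuous f ->
    forall k q, f k q = 0.

(** dim G = n : the real vector space cHom(R, G) (with (r.phi)(x) = phi(r x))
    has dimension n, i.e. it has a basis b_0, ..., b_(n-1). *)
Definition cHomR_basis (R : realType) (G : topologicalZmodType) (n : nat)
    (b : 'I_n -> R -> G) : Prop :=
  (forall i, additive_map (b i) /\ continuous (b i)) /\
  forall g : R -> G, additive_map g -> continuous g ->
    exists! c : 'I_n -> R, forall x, g x = \sum_(i < n) b i (c i * x).

Definition has_dim (R : realType) (G : topologicalZmodType) (n : nat) : Prop :=
  exists b : 'I_n -> R -> G, cHomR_basis b.

Definition compact_group (G : topologicalZmodType) : Prop :=
  compact [set: G] /\ hausdorff_space G.

Definition solenoid (R : realType) (S : topologicalZmodType) : Prop :=
  compact_group S /\ connected [set: S] /\ has_dim R S 1.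

Definition top_iso_prod (G K L : topologicalZmodType) : Prop :=
  exists (f : G -> K * L) (g : K * L -> G),
    additive_map f /\ cancel f g /\ cancel g f /\ continuous f /\ continuous g.

Definition totally_factored (R : realType) (T : topologicalZmodType) : Prop :=
  compact_group T /\ connected [set: T] /\
  exists (I : Type) (S : I -> topologicalZmodType),
    (forall i, solenoid R (S i)) /\
    exists (f : T -> prod_topology S) (g : prod_topology S -> T),
      (forall x y i, f (x + y) i = f x i + f y i) /\
      cancel f g /\ cancel g f /\ continuous f /\ continuous g.

Definition clipped (R : realType) (K : topologicalZmodType) : Prop :=
  ~ exists (S L : topologicalZmodType), solenoid R S /\ top_iso_prod K S L.

(* Main.v *)
(** Split off solenoids one at a time.  Each solenoid factor of a group G
    contributes a one-parameter subgroup, and these are linearly independent in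
    cHom(R, G), so the process stops and leaves a clipped factor K.

    A clipped K admits no nonzero f : T -> K and no nonzero f : K -> Q^vee.
    Given f : T -> K, let d > 0 be the least integer such that some character
    chi of K satisfies chi (f t) = d t.  As characters separate points,
    f (1/d) = 0, so f factors as f t = s (d t), and chi is a retraction of s.
    Given f : K -> Q^vee, connectedness makes f surjective.  Let L be a minimal
    closed subgroup with f(L) = Q^vee.  Since m L also maps onto Q^vee, m L = L,
    hence the kernel N of f on L is divisible.  For a character chi not
    vanishing on N, minimality forces chi(N) to be a proper closed subgroup of
    T, hence of finite exponent, which contradicts divisibility; thus f is an
    isomorphism from L to Q^vee, and L splits.

    That characters separate the points of a compact abelian group G is proved
    without Haar measure, in the spirit of Folner and Prodanov: every finite
    subset of G lies in the image of an approximate homomorphism from some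
    (Z/n)^m, Parseval's identity there yields a large Fourier coefficient of the
    pull-back of a continuous function, and the corresponding characters of
    (Z/n)^m accumulate, by Tychonoff, at a continuous character of G. *)

Require Import Defs.
From HB Require Import structures.
From mathcomp Require Import all_boot all_order all_algebra ring_quotient generic_quotient.
From mathcomp Require Import all_classical all_reals all_analysis.
From mathcomp Require Import ring lra zify.

Set Implicit Arguments.
Unset Strict Implicit.
Unset Printing Implicit Defensive.

Import Order.TTheory GRing.Theory Num.Theory numFieldTopology.Exports numFieldNormedType.Exports.
Local Open Scope classical_set_scope.
Local Open Scope ring_scope.
Local Open Scope quotient_scope.

(** * The circle group *)

Definition cpi (R : realType) (x : R) : circle R := \pi_(Quotient.quot (intZ R)) x.

Section circle_group.
Variable R : realType.
Local Notation T := (circle R).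
Implicit Types (x y : R) (s t : T).

Lemma cpiD x y : cpi (x + y) = cpi x + cpi y.
Proof. exact: (raddfD (\pi_(Quotient.quot (intZ R)))). Qed.

Lemma cpi0 : cpi 0 = 0 :> T.
Proof. exact: (raddf0 (\pi_(Quotient.quot (intZ R)))). Qed.

Lemma cpiN x : cpi (- x) = - cpi x.
Proof. exact: (raddfN (\pi_(Quotient.quot (intZ R)))). Qed.

Lemma cpiB x y : cpi (x - y) = cpi x - cpi y.
Proof. by rewrite cpiD cpiN. Qed.

Lemma cpiMn x n : cpi (x *+ n) = cpi x *+ n.
Proof. by elim: n => [|n IH]; rewrite ?mulr0n ?cpi0 // !mulrS cpiD IH. Qed.

Lemma cpi_eqP x y : reflect (cpi x = cpi y) (x - y \is a Num.int).
Proof.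
apply: (iffP idP) => [h|/eqP].
  by apply/eqP; rewrite -(Quotient.idealrBE (intZ R)).
by rewrite -(Quotient.idealrBE (intZ R)).
Qed.

Lemma cpi_eq0 x : (cpi x = 0) <-> (x \is a Num.int).
Proof. by rewrite -cpi0 -[in X in _ <-> X](subr0 x); split => /cpi_eqP. Qed.

Lemma cpi_repr t : cpi (repr t) = t.
Proof. by rewrite /cpi reprK. Qed.

Lemma cpi_surj t : exists x, t = cpi x.
Proof. by exists (repr t); rewrite cpi_repr. Qed.

Lemma cpi_rep t : exists2 x, 0 <= x < 1 & t = cpi x.
Proof.
have [x ->] := cpi_surj t.
exists (x - (Num.floor x)%:~R).
  by have := real_floor_itv (num_real x); rewrite intrD; lra.
apply/cpi_eqP; rewrite (_ : x - _ = (Num.floor x)%:~R) ?intr_int //; ring.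
Qed.

Lemma cpi_rep_half t : exists2 x, `|x| <= 2^-1 & t = cpi x.
Proof.
have [x x01 ->] := cpi_rep t.
have [xh|xh] := leP x 2^-1.
  by exists x => //; rewrite ger0_norm //; case/andP: x01.
exists (x - 1); first by rewrite ler0_norm; lra.
by apply/cpi_eqP; rewrite (_ : x - _ = 1) ?rpred1 //; ring.
Qed.

Lemma cpi_continuous : continuous (@cpi R : R -> T).
Proof. exact: (@pi_continuous (Rtop R) (Quotient.quot (intZ R))). Qed.

Lemma cosD2piZ (a : R) (m : int) : cos (a + 2 * pi * m%:~R) = cos a.
Proof.
have -> : 2 * pi * m%:~R = (pi *+ 2) *~ m :> R by rewrite mulrzr mulr_natl.
have H (n : nat) (b : R) : cos (b + (pi *+ 2) *+ n) = cos b.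
  by elim: n b => [|n IH] b; rewrite ?mulr0n ?addr0 // mulrS addrCA addrC cosD2pi IH.
case: m => n; first exact: H.
by rewrite NegzE mulrNz -pmulrn -[LHS](H n.+1) subrK.
Qed.

Lemma sinD2piZ (a : R) (m : int) : sin (a + 2 * pi * m%:~R) = sin a.
Proof.
rewrite -!cosBpihalf -[RHS](cosD2piZ _ m); congr cos; ring.
Qed.

(** The real and imaginary parts of exp(2 pi i t). The Fourier analysis below is carried out with
    these two real functions in place of complex numbers. *)
Definition ccos t : R := cos (2 * pi * repr t).
Definition csin t : R := sin (2 * pi * repr t).

Lemma ccosE x : ccos (cpi x) = cos (2 * pi * x).
Proof.
have /intrP[m hm] : repr (cpi x) - x \is a Num.int by apply/cpi_eqP; rewrite cpi_repr.
rewrite /ccos (_ : repr _ = x + m%:~R); last by rewrite -hm; ring.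
by rewrite mulrDr cosD2piZ.
Qed.

Lemma csinE x : csin (cpi x) = sin (2 * pi * x).
Proof.
have /intrP[m hm] : repr (cpi x) - x \is a Num.int by apply/cpi_eqP; rewrite cpi_repr.
rewrite /csin (_ : repr _ = x + m%:~R); last by rewrite -hm; ring.
by rewrite mulrDr sinD2piZ.
Qed.

Lemma ccosD s t : ccos (s + t) = ccos s * ccos t - csin s * csin t.
Proof.
have [x ->] := cpi_surj s; have [y ->] := cpi_surj t.
by rewrite -cpiD !ccosE !csinE mulrDr cosD.
Qed.

Lemma csinD s t : csin (s + t) = csin s * ccos t + ccos s * csin t.
Proof.
have [x ->] := cpi_surj s; have [y ->] := cpi_surj t.
by rewrite -cpiD !ccosE !csinE mulrDr sinD.
Qed.

Lemma ccosN t : ccos (- t) = ccos t.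
Proof. by have [x ->] := cpi_surj t; rewrite -cpiN !ccosE mulrN cosN. Qed.

Lemma csinN t : csin (- t) = - csin t.
Proof. by have [x ->] := cpi_surj t; rewrite -cpiN !csinE mulrN sinN. Qed.

Lemma ccos0 : ccos 0 = 1. Proof. by rewrite -cpi0 ccosE mulr0 cos0. Qed.
Lemma csin0 : csin 0 = 0. Proof. by rewrite -cpi0 csinE mulr0 sin0. Qed.

Lemma ccosB s t : ccos (s - t) = ccos s * ccos t + csin s * csin t.
Proof. by rewrite ccosD ccosN csinN; ring. Qed.

Lemma ccos2Dcsin2 t : ccos t ^+ 2 + csin t ^+ 2 = 1.
Proof. by rewrite /ccos /csin cos2Dsin2. Qed.

Lemma ccos_le1 t : ccos t <= 1. Proof. exact: cos_le1. Qed.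

Lemma ccos_gt t (d : R) : 0 <= d <= 2^-1 -> cos (2 * pi * d) < ccos t ->
  exists2 x, `|x| < d & t = cpi x.
Proof.
move=> /andP[d0 d1]; have [x hx ->] := cpi_rep_half t; rewrite ccosE => h.
exists x => //; have := pi_gt0 R; set p := pi => p0.
have E : cos (2 * p * x) = cos (2 * p * `|x|).
  by have [x0|x0] := ger0P x; rewrite ?mulrN ?cosN.
by move: h; rewrite E ltr_cos ?in_itv /= -?mulrA ?ltr_pM2l //;
  have := normr_ge0 x; nra.
Qed.

Lemma ccos_eq1 t : ccos t = 1 -> t = 0.
Proof.
have [x hx ->] := cpi_rep_half t; rewrite ccosE => h.
have := pi_gt0 R; set p := pi => p0.
have E : cos (2 * p * x) = cos (2 * p * `|x|).
  by have [x0|x0] := ger0P x; rewrite ?mulrN ?cosN.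
have : 2 * p * `|x| = 0.
  by apply: cos_inj; rewrite ?cos0 -?E // in_itv /=; have := normr_ge0 x; nra.
move/eqP; rewrite mulf_eq0 normr_eq0 => /orP[|/eqP ->]; last exact: cpi0.
by rewrite mulf_eq0 (gt_eqF p0) orbF pnatr_eq0.
Qed.

Lemma ccos_continuous : continuous ccos.
Proof.
apply/(@quotient_continuous (Rtop R) (Quotient.quot (intZ R))) => x.
rewrite /comp (_ : (fun x => _) = (fun x => cos (2 * pi * x))); last first.
  by apply/funext => y; exact: ccosE.
apply: (@continuous_comp _ _ _ (fun x : R => 2 * pi * x) cos).
  by apply: continuousM; [exact: cst_continuous|exact: id].
exact: continuous_cos.
Qed.

Lemma csin_continuous : continuous csin.
Proof.
apply/(@quotient_continuous (Rtop R) (Quotient.quot (intZ R))) => x.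
rewrite /comp (_ : (fun x => _) = (fun x => sin (2 * pi * x))); last first.
  by apply/funext => y; exact: csinE.
apply: (@continuous_comp _ _ _ (fun x : R => 2 * pi * x) sin).
  by apply: continuousM; [exact: cst_continuous|exact: id].
exact: continuous_sin.
Qed.

Lemma circle_compact : compact [set: T].
Proof.
have -> : [set: T] = @cpi R @` `[0, 1].
  rewrite eqEsubset; split => // t _; have [x x01 ->] := cpi_rep t.
  by exists x => //=; rewrite in_itv /=; lra.
apply: continuous_compact; last exact: segment_compact.
exact/continuous_subspaceT/cpi_continuous.
Qed.

Lemma ccosB_continuous_at (X : topologicalType) (f : X -> T) (z : X) s :
  {for z, continuous (ccos \o f)} -> {for z, continuous (csin \o f)} ->
  {for z, continuous (fun w : X => ccos (f w - s))}.
Proof.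
move=> fc fs.
rewrite (_ : (fun w : X => _) =
    (fun w : X => (ccos \o f) w * ccos s + (csin \o f) w * csin s)).
  by apply: cvgD; apply: cvgM; [exact: fc|exact: cvg_cst|exact: fs|exact: cvg_cst].
by apply/funext => w; rewrite ccosB.
Qed.

Lemma ccosB_continuous s : continuous (fun t => ccos (t - s)).
Proof.
move=> t; apply: (@ccosB_continuous_at T id).
  exact: ccos_continuous.
exact: csin_continuous.
Qed.

Lemma circle_hausdorff : hausdorff_space T.
Proof.
move=> s t st; apply: subr0_eq; apply: ccos_eq1.
apply: (@Rhausdorff R) => A B nA nB.
have nA' : nbhs s [set u | A (ccos (u - t))] by exact: ccosB_continuous.
have nB' : nbhs t [set u | B (ccos (u - t))].
  by apply: ccosB_continuous; rewrite subrr ccos0.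
by have [u [/= Au Bu]] := st _ _ nA' nB'; exists (ccos (u - t)).
Qed.

(** The continuous function [ccos (s - t)] maps the compact complement of an open neighbourhood of
    [t] to a closed set missing 1. Closeness on the circle can thus be measured by [ccos] of the
    difference. *)
Lemma circle_nbhs t (N : set T) : nbhs t N ->
  exists2 e : R, 0 < e & forall s, 1 - e < ccos (s - t) -> N s.
Proof.
move=> Nt; pose U := N°.
have oU : open U by exact: open_interior.
have Ut : U t by [].
have UN : U `<=` N by exact: interior_subset.
have cU : compact (~` U).
  by apply: (subclosed_compact _ circle_compact) => //; exact: open_closedC.
have : closed ((fun s => ccos (s - t)) @` (~` U)).
  apply: compact_closed; first exact: Rhausdorff.
  by apply: continuous_compact => //; exact/continuous_subspaceT/ccosB_continuous.
move=> /closed_openC; rewrite openE => /(_ 1) []; last first.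
  move=> e /= e0 he; exists e => // s hs; apply: UN; apply: contrapT => Us.
  have := he (ccos (s - t)); apply; last by exists s.
  by rewrite /ball /=; have := ccos_le1 (s - t); rewrite ltr_norml; lra.
by move=> /= [s Us /ccos_eq1/subr0_eq st]; apply: Us; rewrite st; exact: Ut.
Qed.

Lemma circle_continuous_at (X : topologicalType) (f : X -> T) (z : X) :
  {for z, continuous (ccos \o f)} -> {for z, continuous (csin \o f)} ->
  {for z, continuous f}.
Proof.
move=> fc fs N /circle_nbhs [e e0 eN].
have := @ccosB_continuous_at X f z (f z) fc fs.
move=> /(_ [set r | 1 - e < r]) H.
apply: (@filterS _ _ _ [set y : X | 1 - e < ccos (f y - f z)]).
  by move=> w; exact: eN.
by apply: H; rewrite subrr ccos0; apply: lt_nbhsr; lra.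
Qed.

Lemma circle_sub_continuous : continuous (fun p : T * T => p.1 - p.2).
Proof.
have c1 : continuous (ccos \o fst : T * T -> R).
  by move=> q; apply: continuous_comp; [exact: cvg_fst|exact: ccos_continuous].
have c2 : continuous (ccos \o snd : T * T -> R).
  by move=> q; apply: continuous_comp; [exact: cvg_snd|exact: ccos_continuous].
have s1 : continuous (csin \o fst : T * T -> R).
  by move=> q; apply: continuous_comp; [exact: cvg_fst|exact: csin_continuous].
have s2 : continuous (csin \o snd : T * T -> R).
  by move=> q; apply: continuous_comp; [exact: cvg_snd|exact: csin_continuous].
move=> p; apply: circle_continuous_at.
  rewrite (_ : _ \o _ = fun q : T * T =>
     (ccos \o fst) q * (ccos \o snd) q + (csin \o fst) q * (csin \o snd) q); last first.
    by apply/funext => q /=; rewrite ccosB.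
  apply: cvgD; apply: cvgM; [exact: c1|exact: c2|exact: s1|exact: s2].
rewrite (_ : _ \o _ = fun q : T * T =>
   (csin \o fst) q * (ccos \o snd) q - (ccos \o fst) q * (csin \o snd) q); last first.
  by apply/funext => q /=; rewrite csinD ccosN csinN mulrN.
by apply: cvgB; apply: cvgM; [exact: s1|exact: c2|exact: c1|exact: s2].
Qed.

End circle_group.

(** * Fourier analysis on finite abelian groups *)

Section FiniteFourier.
Variables (R : realType) (A B : finZmodType) (theta : B -> A -> circle R).
Hypothesis thetaDl : forall x, additive_map (theta^~ x).
Hypothesis thetaDr : forall k, additive_map (theta k).
Hypothesis theta_nondeg : forall x, x != 0 -> exists k, theta k x != 0.

Lemma additive_map0 (U V : zmodType) (f : U -> V) : additive_map f -> f 0 = 0.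
Proof. by move=> fD; apply: (@addrI _ (f 0)); rewrite -fD !addr0. Qed.

Lemma additive_mapN (U V : zmodType) (f : U -> V) x :
  additive_map f -> f (- x) = - f x.
Proof.
by move=> fD; apply: (@addrI _ (f x)); rewrite -fD !subrr additive_map0.
Qed.

Lemma additive_mapB (U V : zmodType) (f : U -> V) x y :
  additive_map f -> f (x - y) = f x - f y.
Proof. by move=> fD; rewrite fD additive_mapN. Qed.

Lemma additive_mapMn (U V : zmodType) (f : U -> V) x n :
  additive_map f -> f (x *+ n) = f x *+ n.
Proof.
by move=> fD; elim: n => [|n IH]; rewrite ?mulr0n ?additive_map0 // !mulrS fD IH.
Qed.

(* Shifting the summation index by k multiplies the sum, seen as a complex
   number, by the nontrivial phase [theta k z]. *)
Lemma sum_ccos z :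
  \sum_k ccos (theta k z) = (if z == 0 then #|B|%:R else 0) :> R.
Proof.
case: eqP => [->|/eqP z0].
  under eq_bigr => k _ do rewrite (additive_map0 (thetaDr k)) ccos0.
  by rewrite sumr_const.
have [k tk] := theta_nondeg z0.
set C := \sum_k _; set S := \sum_k csin (theta k z).
have EC : C = C * ccos (theta k z) - S * csin (theta k z).
  rewrite {1}/C (reindex_inj (addrI k)) /C /S !mulr_suml -sumrB.
  by apply: eq_bigr => i _; rewrite thetaDl ccosD; ring.
have ES : S = S * ccos (theta k z) + C * csin (theta k z).
  rewrite {1}/S (reindex_inj (addrI k)) /C /S !mulr_suml -big_split /=.
  by apply: eq_bigr => i _; rewrite thetaDl csinD; ring.
have H := ccos2Dcsin2 (theta k z).
have c1 : ccos (theta k z) < 1.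
  rewrite lt_neqAle ccos_le1 andbT; apply: contra tk => /eqP /ccos_eq1 ->.
  exact: eqxx.
move: EC ES H c1; set c := ccos _; set s := csin _ => EC ES H c1.
suff : C * (2 - 2 * c) = 0 by move/eqP; rewrite mulf_eq0 => /orP[/eqP//|]; lra.
have E1 : C * (1 - c) = - S * s by lra.
have E2 : S * (1 - c) = C * s by lra.
have : C * (1 - c) ^+ 2 = - C * s ^+ 2.
  have -> : C * (1 - c) ^+ 2 = C * (1 - c) * (1 - c) by ring.
  rewrite E1 (_ : - S * s * (1 - c) = - (S * (1 - c)) * s); last ring.
  rewrite E2; ring.
rewrite (_ : s ^+ 2 = 1 - c ^+ 2); last by rewrite -H; ring.
move=> E; rewrite (_ : C * (2 - 2 * c) = C * (1 - c) ^+ 2 + C * (1 - c ^+ 2)).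
  by rewrite E; ring.
ring.
Qed.

Variable g : A -> R.
(** [h] is the autocorrelation of [g], and [P k] is the squared modulus of the Fourier coefficient
    of [g] at [k]. *)
Let h z := \sum_y g (y + z) * g y.
Let P k : R := (\sum_x g x * ccos (theta k x)) ^+ 2
  + (\sum_x g x * csin (theta k x)) ^+ 2.

Lemma power_correlation k : P k = \sum_z h z * ccos (theta k z).
Proof.
have -> : P k = \sum_y \sum_x g x * g y * ccos (theta k (x - y)).
  rewrite /P !expr2 !big_distrlr /= -big_split /= exchange_big /=.
  apply: eq_bigr => y _; rewrite -big_split /=; apply: eq_bigr => x _.
  by rewrite (additive_mapB _ _ (thetaDr k)) ccosB; ring.
under eq_bigr => y _.
  rewrite (reindex_inj (addrI y)).
  under eq_bigr => z _ do rewrite addrAC subrr add0r.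
  over.
rewrite exchange_big /=; apply: eq_bigr => z _.
by rewrite /h mulr_suml.
Qed.

Lemma correlationN z : h (- z) = h z.
Proof.
rewrite /h (reindex_inj (addIr z)); apply: eq_bigr => y _.
by rewrite addrK mulrC.
Qed.

Lemma sum_power : \sum_k P k = #|B|%:R * h 0.
Proof.
under eq_bigr => k _ do rewrite power_correlation.
rewrite exchange_big /=.
under eq_bigr => z _ do rewrite -mulr_sumr sum_ccos.
rewrite (bigD1 0) //= big1 ?addr0; first by rewrite eqxx mulrC.
by move=> z z0; rewrite (negbTE z0) mulr0.
Qed.

(** Parseval's identity for [h]. A product of cosines is half the sum of the cosines at z - w and z
    + w; orthogonality keeps only w = z and w = -z, which contribute equally because [h] is even. *)
Lemma sum_power_sqr : \sum_k P k ^+ 2 = #|B|%:R * \sum_z h z ^+ 2.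
Proof.
have E k : P k ^+ 2 = \sum_z \sum_w h z * h w / 2 *
    (ccos (theta k (z - w)) + ccos (theta k (z + w))).
  rewrite power_correlation expr2 big_distrlr /=.
  apply: eq_bigr => z _; apply: eq_bigr => w _.
  rewrite (additive_mapB _ _ (thetaDr k)) (thetaDr k z w) ccosB ccosD.
  by field.
under eq_bigr => k _ do rewrite E.
rewrite exchange_big /= mulr_sumr; apply: eq_bigr => z _.
rewrite exchange_big /=.
have E2 w : \sum_k h z * h w / 2 *
    (ccos (theta k (z - w)) + ccos (theta k (z + w))) =
    h z * h w / 2 * (if w == z then #|B|%:R else 0) +
    h z * h w / 2 * (if w == - z then #|B|%:R else 0).
  rewrite -mulr_sumr big_split /= !sum_ccos mulrDr subr_eq0 (eq_sym z w).
  by rewrite addrC [in X in X + _]addrC addr_eq0 [in RHS]addrC.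
under eq_bigr => w _ do rewrite E2.
rewrite big_split /= (bigD1 z) //= big1 ?addr0; last first.
  by move=> w /negbTE ->; rewrite mulr0.
rewrite [X in _ + X](bigD1 (- z)) //= [X in _ + (_ + X)]big1 ?addr0; last first.
  by move=> w /negbTE ->; rewrite mulr0.
by rewrite !eqxx correlationN; field.
Qed.

(** By the two Parseval sums, the average of [P] weighted by [P] itself is the sum of the [h z ^+ 2]
    divided by [h 0], so some value of [P] reaches it. Arguing by contradiction avoids the
    division. *)
Lemma large_coefficient : exists k, \sum_z h z ^+ 2 <= P k * h 0.
Proof.
apply: contrapT => /forallNP H.
have Pk k : P k * h 0 < \sum_z h z ^+ 2 by rewrite ltNge; apply/negP/H.
have h0 : 0 <= h 0.
  by apply: sumr_ge0 => y _; rewrite addr0 -expr2 sqr_ge0.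
have P0 k : 0 <= P k by rewrite addr_ge0 ?sqr_ge0.
have Z : \sum_k P k * (\sum_z h z ^+ 2 - P k * h 0) = 0.
  under eq_bigr => k _ do rewrite mulrBr mulrA -expr2.
  by rewrite sumrB -!mulr_suml sum_power sum_power_sqr; ring.
have PZ k : P k = 0.
  have := @psumr_eq0P _ _ predT _ _ Z => /(_ _ k isT) => /(_ _)/eqP.
  rewrite mulf_eq0 subr_eq0 (gt_eqF (Pk k)) orbF => H'; apply/eqP/H' => i _.
  by rewrite mulr_ge0 // subr_ge0 ltW.
have := Pk 0; rewrite PZ mul0r.
have := sum_power_sqr; rewrite big1; last by move=> k _; rewrite PZ expr0n.
move=> /esym/eqP; rewrite mulf_eq0 pnatr_eq0 => /orP[|/eqP -> ]; last by rewrite ltxx.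
by rewrite -leqn0 leqNgt (cardD1 0) inE.
Qed.

End FiniteFourier.

(** * Characters of compact groups separate points *)

Lemma comp_continuous (X Y Z : topologicalType) (f : X -> Y) (g : Y -> Z) :
  continuous f -> continuous g -> continuous (fun x => g (f x)).
Proof. by move=> fc gc x; apply: continuous_comp; [exact: fc|exact: gc]. Qed.

Lemma pair_continuous (X Y Z : topologicalType) (f : X -> Y) (g : X -> Z) :
  continuous f -> continuous g -> continuous (fun x => (f x, g x)).
Proof. by move=> fc gc x; exact: (cvg_pair (fc x) (gc x)). Qed.

Lemma fst_continuous (X Y : topologicalType) : continuous (@fst X Y).
Proof. by move=> p; exact: cvg_fst. Qed.

Lemma snd_continuous (X Y : topologicalType) : continuous (@snd X Y).
Proof. by move=> p; exact: cvg_snd. Qed.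

Lemma addf_continuous (X : topologicalType) (G : topologicalZmodType) (f g : X -> G) :
  continuous f -> continuous g -> continuous (fun x => f x + g x).
Proof.
move=> fc gc; exact: (comp_continuous (pair_continuous fc gc) (@add_continuous G)).
Qed.

Lemma subf_continuous (X : topologicalType) (G : topologicalZmodType) (f g : X -> G) :
  continuous f -> continuous g -> continuous (fun x => f x - g x).
Proof.
move=> fc gc; exact: (comp_continuous (pair_continuous fc gc) (@sub_continuous G)).
Qed.

(** The family generates a proper filter, and a cluster point lies in every member because the
    members are closed. This is how compactness turns approximate or partial solutions into exact
    ones. *)
Lemma directed_closed_meet (T : topologicalType) (I : Type) (F : I -> set T) :
  compact [set: T] -> inhabited I -> (forall i, closed (F i)) ->
  (forall i, F i !=set0) ->
  (forall i j, exists k, F k `<=` F i `&` F j) ->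
  exists x, forall i, F i x.
Proof.
move=> cT [i0] cF F0 dF.
pose FF := filter_from [set: I] F.
have pF : ProperFilter FF.
  apply: filter_from_proper => //.
  apply: filter_from_filter; first by exists i0.
  by move=> i j _ _; have [k hk] := dF i j; exists k.
have [x [_ xF]] := cT FF pF filterT.
exists x => i; apply: (cF i) => N Nx.
by apply: xF => //; exists i.
Qed.

(** * Compact groups: covering by translates and approximation by finite groups *)

Section TopGroup.
Variable G : topologicalZmodType.
Implicit Types (U V : set G) (x y : G).

Lemma nbhs0_sub U : nbhs 0 U ->
  exists2 V, nbhs 0 V & forall x y, V x -> V y -> U (x - y).
Proof.
move=> nU; have /= := @sub_continuous G (0, 0) U.
rewrite /= subrr => /(_ nU) [[V W] /= [nV nW] VW].
exists (V `&` W); first exact: filterI.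
by move=> x y [Vx _] [_ Wy]; exact: (VW (x, y)).
Qed.

Lemma nbhs0_add U : nbhs 0 U ->
  exists2 V, nbhs 0 V & forall x y, V x -> V y -> U (x + y).
Proof.
move=> nU; have /= := @add_continuous G (0, 0) U.
rewrite /= addr0 => /(_ nU) [[V W] /= [nV nW] VW].
exists (V `&` W); first exact: filterI.
by move=> x y [Vx _] [_ Wy]; exact: (VW (x, y)).
Qed.

Lemma nbhs0_opp U : nbhs 0 U -> nbhs 0 [set x | U (- x)].
Proof. by move=> nU; have := @opp_continuous G 0 U; rewrite /= oppr0; exact. Qed.

Lemma addl_continuous x : continuous (fun y => x + y).
Proof. by apply: addf_continuous => y; [exact: cvg_cst|exact: cvg_id]. Qed.

Lemma nbhs_translate x U : nbhs 0 U -> nbhs x [set y | U (y - x)].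
Proof.
move=> nU; have := @addl_continuous (- x) x U; rewrite /= addNr => /(_ nU) H.
by rewrite (_ : [set y | _] = (fun y => U (- x + y))) //; apply/funext => y /=; rewrite addrC.
Qed.

Lemma nbhs0_sum m U : nbhs 0 U -> exists2 V, nbhs 0 V &
  forall u : 'I_m -> G, (forall j, V (u j)) -> U (\sum_j u j).
Proof.
elim: m U => [|m IH] U nU.
  by exists setT; [exact: filterT|move=> u _; rewrite big_ord0; exact: nbhs_singleton].
have [V nV VU] := nbhs0_add nU; have [W nW WV] := IH _ nV.
exists (V `&` W); first exact: filterI.
move=> u hu; rewrite big_ord_recl; apply: VU; first by have [] := hu ord0.
by apply: WV => j; have [] := hu (lift ord0 j).
Qed.

Hypothesis cG : compact [set: G].

Lemma compact_translates U : nbhs 0 U ->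
  exists (r : nat) (b : 'I_r.+1 -> G), forall x, exists i, U (x - b i).
Proof.
move=> nU; have [s hs] : exists s : seq G, forall x, exists2 b, b \in s & U (x - b).
  apply: contrapT => /forallNP H.
  pose F (s : seq G) := [set x | forall b, b \in s -> ~ U (x - b)].
  have pF : ProperFilter (filter_from [set: seq G] F).
    apply: filter_from_proper => [|s _].
      apply: filter_from_filter; first by exists [::].
      move=> s t _ _; exists (s ++ t) => // x Fx; split=> b hb; apply: Fx;
        by rewrite mem_cat hb ?orbT.
    have /existsNP [x hx] := H s; exists x => b bs Ub; apply: hx.
    by exists b.
  have [x [_ xF]] := cG pF filterT.
  have [|y [Fy Uy]] := xF (F [:: x]) _ _ (nbhs_translate x nU).
    by exists [:: x].
  by apply: (Fy x) => //; rewrite inE.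
(* One extra index, carrying the default value 0, keeps the index type visibly nonempty. *)
exists (size s), (fun i => nth 0 s i) => x; have [b bs Ub] := hs x.
have iD : (index b s < (size s).+1)%N by rewrite ltnS index_size.
by exists (Ordinal iD); rewrite /= nth_index.
Qed.

(** Dirichlet's pigeonhole argument: there are finitely many ways to assign to the [s j] one of the
    translates covering [G] each, so two multiples k > l give the same assignment, and k - l
    works. *)
Lemma simultaneous_approximation m U : nbhs 0 U ->
  forall s : 'I_m -> G, exists n, forall j, U (s j *+ n.+1).
Proof.
move=> nU s; have [V nV VU] := nbhs0_sub nU.
have [r [b bV]] := compact_translates nV.
have /boolp.choice [c hc] : forall x, exists i, V (x - b i) by [].
pose f (k : 'I_(#|{ffun 'I_m -> 'I_r.+1}|).+1) := [ffun j => c (s j *+ k)].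
have /injectivePn [k [l kl fkl]] : ~~ injectiveb f.
  apply/negP => /injectiveP /leq_card; rewrite card_ord ltnn //.
wlog lk : k l kl fkl / (l < k)%N.
  move=> H; have := kl; rewrite neq_ltn => /orP[lk|lk]; last exact: (H k l).
  by apply: (H l k) => //; rewrite eq_sym.
exists (k - l).-1 => j.
rewrite prednK ?subn_gt0 // mulrnBr ?(ltnW lk) //.
have -> : s j *+ k - s j *+ l = (s j *+ k - b (f k j)) - (s j *+ l - b (f l j)).
  by rewrite fkl opprB addrA subrK.
by apply: VU; rewrite ffunE; exact: hc.
Qed.

Lemma uniformly_continuous_translation (R : realType) (f : G -> R) (e : R) :
  continuous f -> 0 < e ->
  exists2 U, nbhs 0 U & forall x u, U u -> `|f (x + u) - f x| < e.
Proof.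
move=> fc e0; move/compact_near_coveringP: cG.
move=> /(_ G (nbhs 0) (fun u x => `|f (x + u) - f x| < e) _) H.
have {H} : \forall u \near 0, [set: G] `<=` (fun x => `|f (x + u) - f x| < e).
  apply: H => x _.
  have c1 : {for (x, 0 : G), continuous (fun p : G * G => f (p.1 + p.2) - f p.1)}.
    apply: cvgB.
      apply: (@continuous_comp _ _ _ (fun p : G * G => p.1 + p.2) f).
        exact: add_continuous.
      exact: fc.
    apply: (@continuous_comp _ _ _ fst f); first exact: cvg_fst.
    exact: fc.
  have := c1 [set r | `|r| < e]; rewrite /= addr0 subrr => H.
  have : nbhs (0 : R) [set r | `|r| < e].
    by exists e => // r; rewrite /ball /= sub0r normrN.
  by move=> /H.
by move=> H; exists [set u | [set: G] `<=` (fun x => `|f (x + u) - f x| < e)] => // x u; exact.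
Qed.

(* By simultaneous approximation one may pick [n] such that every [s j *+ n] is
   close to 0; the carries of addition modulo [n] are then harmless. *)
Lemma finite_approximation m (s : 'I_m -> G) U : nbhs 0 U ->
  exists (n : nat) (p : 'rV['Z_n.+2]_m -> G),
    (forall k l, U (p (k + l) - p k - p l)) /\
    (forall j, p (delta_mx 0 j) = s j).
Proof.
move=> nU; have [V nV VU] := @nbhs0_sum m U nU.
have [W' nW' W'W] := nbhs0_add (filterI nV (nbhs0_opp nV)).
have [n hn] := simultaneous_approximation nW' s.
(* The multiple is doubled so that the modulus 2(n + 1) has the form [_.+2]. *)
have hn2 j : V (- (s j *+ (n.+1 + n.+1))).
  by rewrite mulrnDr; have [] := W'W _ _ (hn j) (hn j).
have V0 : V 0 by exact: nbhs_singleton.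
have e2 : (n.+1 + n.+1 = (n + n).+2)%N by rewrite addnS addSn.
exists (n + n)%N, (fun k : 'rV['Z_(n + n).+2]_m => \sum_j s j *+ (k 0 j : nat)); split => [k l|j].
  rewrite -!sumrB; apply: VU => j.
  rewrite mxE /= -addrA -opprD -mulrnDr.
  set a := (k 0 j : nat); set b := (l 0 j : nat).
  (* Two residues add up to less than twice the modulus, so the carry is 0 or 1, and the error in
     coordinate j is 0 or the small element of [hn2]. *)
  have ab : ((a + b) %/ (n + n).+2 < 2)%N.
    rewrite ltn_divLR // mul2n -addnn.
    have := ltn_ord (k 0 j); have := ltn_ord (l 0 j); rewrite -/a -/b /Zp_trunc /=; lia.
  rewrite {2}(divn_eq (a + b) (n + n).+2) mulrnDr opprD addrCA subrr addr0 mulnC mulrnA.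
  case: (_ %/ _)%N ab => [|[|//]] _; first by rewrite mulr0n oppr0.
  by rewrite mulr1n -e2.
rewrite (bigD1 j) //= mxE !eqxx /= big1 ?addr0 //.
by move=> i ij; rewrite mxE (negbTE ij) andbF /= mulr0n.
Qed.
End TopGroup.

Lemma cyclic_character (R : realType) (n : nat) (i j : 'Z_n.+2) :
  let z (i : 'Z_n.+2) := cpi ((i : nat)%:R / n.+2%:R : R) in
  z (i + j) = z i + z j /\ (z i = 0 -> i = 0).
Proof.
move=> z; split.
  rewrite /z -cpiD; apply/cpi_eqP.
  have -> : ((i + j)%R : nat) = ((i + j) %% n.+2)%N by [].
  rewrite -mulrDl -natrD {2}(divn_eq (i + j) n.+2).
  rewrite natrD natrM mulrDl mulfK ?pnatr_eq0 // opprD addrCA subrr addr0.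
  by rewrite rpredN rpred_nat.
rewrite /z => /cpi_eq0 /intrP [m hm].
have iN : ((i : nat) < n.+2)%N by exact: ltn_ord.
have E : (i : nat)%:R = m%:~R * n.+2%:R :> R by rewrite -hm mulfVK ?pnatr_eq0.
have {}E : (i : nat)%:Z = m * n.+2%:Z.
  by apply/eqP; rewrite -(eqr_int R) intrM; apply/eqP.
apply: val_inj => /=; move: E iN; set a := nat_of_ord i.
case: m {hm} => [[|k]|k] E aN; first by move: E; rewrite mul0r => -[].
  by move: E; rewrite -PoszM => -[E]; move: aN; rewrite E mulSn; lia.
by move: E; rewrite NegzE mulNr -PoszM; lia.
Qed.

Lemma cyclic_power_pairing (R : realType) n m :
  exists theta : 'rV['Z_n.+2]_m -> 'rV['Z_n.+2]_m -> circle R,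
  [/\ forall x, additive_map (theta^~ x), forall k, additive_map (theta k)
    & forall x, x != 0 -> exists k, theta k x != 0].
Proof.
exists (fun k x => cpi ((((k *m x^T) 0 0 : 'Z_n.+2) : nat)%:R / n.+2%:R)); split.
- move=> x k l; rewrite mulmxDl mxE; exact: (cyclic_character R _ _).1.
- move=> k x y; rewrite linearD mulmxDr mxE; exact: (cyclic_character R _ _).1.
move=> x /eqP x0; apply: contrapT => /forallNP H; apply: x0.
apply/rowP => j; rewrite mxE; apply: (cyclic_character R _ 0).2.
have /negP := H (delta_mx 0 j); rewrite negbK => /eqP <-.
by rewrite -rowE !mxE.
Qed.

(** * Recurrence of approximate homomorphisms and large Fourier coefficients *)

Section ReturnTimes.
Variable G : topologicalZmodType.
Hypothesis cG : compact [set: G].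

(** Some translate in a finite cover of [G] receives at least |A| / (r + 1) of the values of [p].
    Subtracting one element of that class from the others gives elements that [p], being almost
    additive, sends into [U]. The bound depends on [U] only, not on [A]. *)
Lemma return_density (U : set G) : nbhs 0 U ->
  exists (r : nat) (W : set G), nbhs 0 W /\
  forall (A : finZmodType) (p : A -> G),
    (forall k l, W (p (k + l) - p k - p l)) ->
    (#|A| <= r.+1 * #|[pred z | `[< U (p z) >]]|)%N.
Proof.
move=> nU; have [V nV VU] := nbhs0_sub nU; have [V' nV' VV'] := nbhs0_sub nV.
have [r [b bV]] := compact_translates cG nV'.
exists r, V; split => // A p pW.
have /boolp.choice [c hc] : forall x : A, exists i, V' (p x - b i) by [].
have [i hi] : exists i, (#|A| <= r.+1 * #|[pred x | c x == i]|)%N.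
  apply: contrapT => /forallNP H.
  have : (\sum_(i < r.+1) r.+1 * #|[pred x | c x == i]| <= \sum_(i < r.+1) #|A|.-1)%N.
    apply: leq_sum => i _; rewrite -ltnS prednK; last by apply/card_gt0P; exists 0.
    by rewrite ltnNge; apply/negP/H.
  rewrite -big_distrr /= sum_nat_const card_ord leq_pmul2l //.
  rewrite -(eq_bigr _ (fun i _ => sum1_card _)) /=.
  rewrite (exchange_big_dep predT) //=.
  rewrite (eq_bigr (fun=> 1%N)) ?sum1_card.
    have : (0 < #|A|)%N by apply/card_gt0P; exists 0.
    by case: #|A| => // k _; rewrite ltnn.
  by move=> x _; rewrite (big_pred1 (c x)) // => j; rewrite !inE eq_sym.
apply: (leq_trans hi); rewrite leq_pmul2l //.
case: (pickP [pred x | c x == i]) => [x0 /= /eqP hx0|/eq_card0 -> //].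
rewrite -(fintype.card_image (addIr (- x0))); apply: subset_leq_card.
apply/fintype.subsetP => w /mapP [x]; rewrite mem_enum !inE => /eqP hx ->.
have -> : p (x - x0) = (p x - p x0) - (p (x - x0 + x0) - p (x - x0) - p x0).
  by rewrite subrK opprB addrA subrK opprB addrC subrK.
apply: VU => //.
have -> : p x - p x0 = (p x - b i) - (p x0 - b i) by rewrite opprB addrA subrK.
by apply: VV'; [rewrite -hx|rewrite -hx0].
Qed.

Variables (R : realType) (f : G -> R).
Hypotheses (fc : continuous f) (f1 : forall x, `|f x| <= 1) (f0 : f 0 = 1).

(** The autocorrelation of [f \o p] stays of order |A| at every z with [p z] near 0, and such z have
    positive density by [return_density]. So the sum of its squares is of order |A|^3, and
    [large_coefficient] gives a squared modulus of order |A|^2. [kappa] is fixed before [U], [s] and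
    [A]. *)
Lemma large_twisted_average : exists2 kappa : R, 0 < kappa &
  forall (U : set G), nbhs 0 U -> forall m (s : 'I_m -> G),
  exists (A : finZmodType) (p : A -> G) (theta : A -> circle R) (e : 'I_m -> A),
  [/\ forall k l, U (p (k + l) - p k - p l), additive_map theta,
      forall j, p (e j) = s j &
      kappa * #|A|%:R ^+ 2 <= (\sum_y f (p y) * ccos (theta y)) ^+ 2
                            + (\sum_y f (p y) * csin (theta y)) ^+ 2].
Proof.
have q0 : 0 < 4^-1 :> R by rewrite invr_gt0.
have [U1 nU1 fU1] := uniformly_continuous_translation cG fc q0.
have [r [W [nW hW]]] := return_density nU1.
(* [mu] bounds the mean of the square of [f \o p] from below: f > 3/4 on [U1], so f^2 > 1/2 there,
   and [p] visits [U1] with density at least 1 / (r + 1). *)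
pose mu : R := 2^-1 / r.+1%:R.
have mu0 : 0 < mu by rewrite divr_gt0 // ltr0n.
have mu4 : 0 < mu / 4 by rewrite divr_gt0.
have [U2 nU2 fU2] := uniformly_continuous_translation cG fc mu4.
have [r' [W' [nW' hW']]] := return_density nU2.
exists (mu ^+ 2 / 4 / r'.+1%:R).
  by rewrite !divr_gt0 ?exprn_gt0 // ltr0n.
move=> U nU m s.
have [n [p [pU ps]]] := finite_approximation cG s
  (filterI nU (filterI (filterI nW nW') nU2)).
have [theta [tDl tDr tnd]] := cyclic_power_pairing R n m.
set A := 'rV['Z_n.+2]_m in p pU ps theta tDl tDr tnd *.
pose g x := f (p x).
have [k hk] := large_coefficient tDl tDr tnd g.
exists A, p, (theta k), (delta_mx 0); split => // [x y|]; first by have [] := pU x y.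
move: hk; set P := (X in X * _); set h := fun z => \sum_y g (y + z) * g y.
rewrite -/(h 0) => hk.
set a : R := #|A|%:R.
have a0 : 0 < a by rewrite ltr0n; apply/card_gt0P; exists 0.
have g1 x : `|g x| <= 1 by exact: f1.
have h0E : h 0 = \sum_y g y ^+ 2.
  by apply: eq_bigr => y _; rewrite addr0.
have h0a : h 0 <= a.
  rewrite h0E /a -sum1_card natr_sum; apply: ler_sum => y _.
  by rewrite -real_normK ?num_real // expr_le1.
have h0mu : a * mu <= h 0.
  have le1 : a <= r.+1%:R * #|[pred z | `[< U1 (p z) >]]|%:R.
    rewrite -natrM ler_nat; apply: hW => x y.
    by have [_ [[]]] := pU x y.
  have : #|[pred z | `[< U1 (p z) >]]|%:R * 2^-1 <= h 0.
    rewrite h0E -sum1_card natr_sum mulr_suml big_mkcond /=.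
    apply: ler_sum => y _; case: ifPn => [|_]; last exact: sqr_ge0.
    rewrite inE => Uy; have := fU1 0 _ Uy; rewrite add0r f0 ltr_norml => /andP[h1 h2].
    rewrite mul1r /g; nra.
  apply: le_trans.
  rewrite /mu mulrCA mulrC ler_pM2r // ler_pdivrMr ?ltr0n //.
  by rewrite mulrC.
(* Moving by such a z changes each value of [g] by at most mu / 2, which costs at most half of the
   mean mu. *)
have hlow z : U2 (p z) -> a * (mu / 2) <= h z.
  move=> Uz.
  have close y : `|g (y + z) - g y| <= mu / 2.
    have [_ [_ U2yz]] := pU y z.
    have := fU2 (p y + p z) _ U2yz; have := fU2 (p y) _ Uz.
    have -> : p y + p z + (p (y + z) - p y - p z) = p (y + z).
      by rewrite -[X in _ + X]addrA -opprD [LHS]addrC subrK.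
    rewrite /g !ltr_norml ler_norml => /andP[h1 h2] /andP[h3 h4].
    by apply/andP; split; lra.
  have : \sum_y (g y ^+ 2 - mu / 2) <= h z.
    apply: ler_sum => y _; have := close y; have := g1 y.
    rewrite !ler_norml => /andP[h1 h2] /andP[h3 h4]; nra.
  apply: le_trans; rewrite sumrB -h0E sumr_const -mulr_natl -/a; lra.
have h0p : 0 < h 0 by apply: lt_le_trans h0mu; rewrite mulr_gt0.
rewrite -(ler_pM2r h0p); apply: le_trans hk.
have le2 : a <= r'.+1%:R * #|[pred z | `[< U2 (p z) >]]|%:R.
  rewrite -natrM ler_nat; apply: hW' => x y.
  by have [_ [[]]] := pU x y.
have le3 : #|[pred z | `[< U2 (p z) >]]|%:R * (a * (mu / 2)) ^+ 2 <= \sum_z h z ^+ 2.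
  rewrite -sum1_card natr_sum mulr_suml [X in X <= _]big_mkcond /=.
  apply: ler_sum => y _; case: ifPn => [|_]; last exact: sqr_ge0.
  rewrite inE mul1r => Uy; have hl := hlow _ Uy.
  by rewrite ler_sqr ?nnegrE //; [|apply: le_trans hl]; rewrite ?mulr_ge0 // ltW ?divr_gt0.
apply: le_trans le3.
have R0 : 0 < r'.+1%:R :> R by rewrite ltr0n.
have Na : a / r'.+1%:R <= #|[pred z | `[< U2 (p z) >]]|%:R.
  by rewrite ler_pdivrMr // mulrC.
apply: (@le_trans _ _ (a / r'.+1%:R * (a * (mu / 2)) ^+ 2)); last first.
  by rewrite ler_wpM2r ?sqr_ge0.
have -> : a / r'.+1%:R * (a * (mu / 2)) ^+ 2 = mu ^+ 2 / 4 / r'.+1%:R * a ^+ 2 * a.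
  by field; rewrite gt_eqF.
by rewrite ler_wpM2l // !mulr_ge0 ?invr_ge0 ?exprn_ge0 ?ltW.
Qed.
End ReturnTimes.

(** * Twisted averages under translation and rotation *)

Section TwistedAverage.
Variables (R : realType) (G : topologicalZmodType) (A : finZmodType).
Variables (p : A -> G) (theta : A -> circle R).
Hypothesis thetaD : additive_map theta.

(* The real part of the Fourier coefficient at [theta] of the translate by [t] of
   [u \o p], rotated by the phase [alpha]; the phases replace complex numbers. *)
Definition twisted (u : G -> R) (t : G) (alpha : circle R) : R :=
  (\sum_y u (t + p y) * ccos (theta y + alpha)) / #|A|%:R.

Let card_gt0 : 0 < #|A|%:R :> R.
Proof. by rewrite ltr0n; apply/card_gt0P; exists 0. Qed.

Lemma normr_ccos_le1 (t : circle R) : `|ccos t| <= 1.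
Proof. by rewrite ler_norml ccos_le1 andbT /ccos cos_geN1. Qed.

Lemma average_le (F H : A -> R) (e : R) :
  (forall y, `|F y - H y| <= e) ->
  `|(\sum_y F y) / #|A|%:R - (\sum_y H y) / #|A|%:R| <= e.
Proof.
move=> FH; rewrite -mulrBl -sumrB normrM (gtr0_norm (_ : 0 < _^-1)) ?invr_gt0 //.
rewrite ler_pdivrMr //; apply: (le_trans (ler_norm_sum _ _ _)).
apply: (@le_trans _ _ (\sum_(y : A) e)); first exact: ler_sum.
by rewrite sumr_const mulr_natr.
Qed.

(** Reindexing by y + e0 moves [p e0] into the base point and [theta e0] into the phase; the defect
    of additivity of [p] lies in [U] and costs at most [e]. *)
Lemma twisted_shift u (U : set G) e0 t alpha (e : R) :
  (forall k l, U (p (k + l) - p k - p l)) ->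
  (forall x w, U w -> `|u (x + w) - u x| <= e) ->
  `|twisted u t alpha - twisted u (t + p e0) (alpha + theta e0)| <= e.
Proof.
move=> pU uU; rewrite /twisted (reindex_inj (addIr e0)) /=.
apply: average_le => y.
rewrite thetaD -!addrA (addrC (theta e0)) -mulrBl normrM.
rewrite -[e]mulr1; apply: ler_pM; rewrite ?normr_ge0 ?normr_ccos_le1 //.
have -> : t + p (y + e0) = t + (p e0 + p y) + (p (y + e0) - p y - p e0).
  rewrite -addrA; congr (t + _).
  by rewrite (addrC (p e0)) -[X in _ = _ + X]addrA -opprD [RHS]addrC subrK.
exact: uU.
Qed.

Lemma twisted_translate u d t alpha (e : R) :
  (forall x, `|u (x + d) - u x| <= e) ->
  `|twisted u (t + d) alpha - twisted u t alpha| <= e.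
Proof.
move=> ud; apply: average_le => y; rewrite -mulrBl normrM.
rewrite -[e]mulr1; apply: ler_pM; rewrite ?normr_ge0 ?normr_ccos_le1 //.
by rewrite addrAC.
Qed.

Lemma twistedE u t alpha : twisted u t alpha =
  ccos alpha * ((\sum_y u (t + p y) * ccos (theta y)) / #|A|%:R)
  - csin alpha * ((\sum_y u (t + p y) * csin (theta y)) / #|A|%:R).
Proof.
rewrite /twisted !mulrA -mulrBl; congr (_ / _).
rewrite !mulr_sumr -sumrB; apply: eq_bigr => y _.
by rewrite ccosD; ring.
Qed.

Lemma average_normr_le1 (F : A -> R) : (forall y, `|F y| <= 1) ->
  `|(\sum_y F y) / #|A|%:R| <= 1.
Proof.
move=> F1; have := @average_le F (fun=> 0) 1.
by rewrite big1_eq mul0r subr0; apply => y; rewrite subr0.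
Qed.

End TwistedAverage.

Lemma ccos_quarter (R : realType) : ccos (cpi (4^-1 : R)) = 0.
Proof.
rewrite ccosE (_ : 2 * pi * 4^-1 = pi / 2 :> R) ?cos_pihalf //; by field.
Qed.

Lemma csin_quarter (R : realType) : csin (cpi (4^-1 : R)) = 1.
Proof.
rewrite csinE (_ : 2 * pi * 4^-1 = pi / 2 :> R) ?sin_pihalf //; by field.
Qed.

(** With Z = C + iS, [T alpha] is the real part of exp(2 pi i alpha) Z, and [q] is a quarter turn.
    The two displacements are the real part and, up to sign, the imaginary part of (exp(2 pi i beta)
    - 1) Z; the right side is its squared modulus. *)
Lemma phase_displacement (R : realType) (C S : R) (beta : circle R) :
  let T alpha := ccos alpha * C - csin alpha * S in
  let q := cpi (4^-1 : R) in
  (T beta - T 0) ^+ 2 + (T (q + beta) - T q) ^+ 2 =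
  2 * (1 - ccos beta) * (C ^+ 2 + S ^+ 2).
Proof.
move=> T q; rewrite /T /q ccosD csinD ccos_quarter csin_quarter ccos0 csin0.
have H := ccos2Dcsin2 beta; move: H; set c := ccos _; set s := csin _ => H.
transitivity ((c ^+ 2 + s ^+ 2 + 1 - 2 * c) * (C ^+ 2 + S ^+ 2)); first by ring.
by rewrite H; ring.
Qed.

(** * Approximate characters *)

Section Characters.
Variables (R : realType) (G : topologicalZmodType).
Hypotheses (cG : compact [set: G]) (hG : hausdorff_space G).

Lemma urysohn_point (a : G) : a <> 0 -> exists v : G -> R,
  [/\ continuous v, forall x, 0 <= v x <= 1, v 0 = 1 & v a = 0].
Proof.
move=> a0.
have aG : accessible_space G by exact: hausdorff_accessible.
have nG := compact_normal hG cG.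
have a0' : [set a] `&` [set (0 : G)] = set0.
  by apply/disjoints_subset => x -> /= /a0.
have H := normal_uniform_separator nG (@accessible_closed_set1 _ aG a)
    (@accessible_closed_set1 _ aG 0) a0'.
have [v [vc v01 va v0]] := (@uniform_separatorP G R _ _).1 H.
exists v; split => //.
- by move=> x; have := v01 (v x); rewrite /= in_itv /=; apply; exists x.
- by apply: v0; exists 0.
- by apply: va; exists a.
Qed.

(* Translating by [p k] multiplies the large coefficient provided by
   [large_twisted_average] by the phase [- theta k] up to a small error, so
   [theta k] is determined by [p k] up to a small error. Taking for [f] the
   difference of a bump function and its translate by [a] makes the coefficient
   small unless [theta] is far from 0 at [a]. *)
Lemma approximate_character (a : G) : a <> 0 ->
  exists (c : R) (U : R -> set G), [/\ 0 < c, forall eta, 0 < eta -> nbhs 0 (U eta) &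
  forall (s : seq G) (e : R), 0 < e -> exists theta : G -> circle R,
   [/\ forall x y, x \in s -> y \in s -> x + y \in s ->
         1 - e <= ccos (theta (x + y) - theta x - theta y),
       forall eta x, 0 < eta -> x \in s -> U eta x -> 1 - (eta + e) <= ccos (theta x)
     & a \in s -> ccos (theta a) <= 1 - c]].
Proof.
move=> a0; have [v [vc v01 v0 va]] := urysohn_point a0.
pose f x := v x - v (x + a).
have fc : continuous f.
  move=> x; apply: cvgB; first exact: vc.
  apply: (@continuous_comp _ _ _ (fun x => x + a) v); last exact: vc.
  by apply: addf_continuous => y; [exact: cvg_id|exact: cvg_cst].
have f1 x : `|f x| <= 1.
  by have := v01 x; have := v01 (x + a); rewrite ler_norml /f; lra.
have f0 : f 0 = 1 by rewrite /f v0 add0r va subr0.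
have [kappa k0 hk] := large_twisted_average cG fc f1 f0.
have /boolp.choice [U hU] : forall eta : R, exists U : set G, 0 < eta ->
    nbhs 0 U /\ forall x u, U u -> `|f (x + u) - f x| < Num.min 1 (kappa * eta / 2).
  move=> eta; have [e0|e0] := ltP 0 eta; last by exists setT.
  have m0 : 0 < Num.min 1 (kappa * eta / 2).
    by rewrite lt_min ltr01 divr_gt0 ?mulr_gt0.
  by have [U nU fU] := uniformly_continuous_translation cG fc m0; exists U.
exists (kappa / 16), U; split; first by rewrite divr_gt0.
  by move=> eta /hU [].
move=> s e e0.
(* [d] is at most 1 and so small that (3d)^2 <= kappa e in the first claim and 4 d^2 <= kappa / 2 in
   the last. *)
pose d := Num.min 1 (Num.min (kappa / 8) (kappa * e / 100)).
have d0 : 0 < d by rewrite !lt_min ltr01 !divr_gt0 ?mulr_gt0.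
have [d1 dk de] : [/\ d <= 1, d <= kappa / 8 & d <= kappa * e / 100].
  by split; rewrite /d !ge_min lexx ?orbT.
have [V1 nV1 fV] := uniformly_continuous_translation cG fc d0.
have [V2 nV2 vV] := uniformly_continuous_translation cG vc d0.
have [A [p [th [E [pV thD pE lb]]]]] := hk _ (filterI nV1 nV2) (size s) (tnth (in_tuple s)).
(* On [s], [theta] is read off [th] at some preimage under [p]; elsewhere 0 is a mere default. *)
have /boolp.choice [theta htheta] : forall x, exists t : circle R, x \in s ->
    exists k, t = th k /\ p k = x.
  move=> x; have [xs|_] := boolP (x \in s); last by exists 0.
  have /tnthP [j xj] : x \in in_tuple s by [].
  by exists (th (E j)) => _; exists (E j); split; rewrite // pE -xj.
have A0 : 0 < #|A|%:R :> R by rewrite ltr0n; apply/card_gt0P; exists 0.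
pose T u := twisted p th u.
have shift_f k t al : `|T f t al - T f (t + p k) (al + th k)| <= d.
  apply: (@twisted_shift _ _ _ _ _ thD _ (V1 `&` V2)) => // x w [V1w _].
  exact/ltW/fV.
have shift_v k t al : `|T v t al - T v (t + p k) (al + th k)| <= d.
  apply: (@twisted_shift _ _ _ _ _ thD _ (V1 `&` V2)) => // x w [_ V2w].
  exact/ltW/vV.
pose C u := (\sum_y u (0 + p y) * ccos (th y)) / #|A|%:R.
pose S u := (\sum_y u (0 + p y) * csin (th y)) / #|A|%:R.
have TE u al : T u 0 al = ccos al * C u - csin al * S u by exact: twistedE.
have lbk : kappa <= C f ^+ 2 + S f ^+ 2.
  rewrite /C /S !expr_div_n -mulrDl ler_pdivlMr ?exprn_gt0 //.
  apply: (le_trans lb); rewrite le_eqVlt; apply/orP; left; apply/eqP.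
  by congr (_ ^+ 2 + _ ^+ 2); apply: eq_bigr => y _; rewrite add0r.
pose q := cpi (4^-1 : R).
(* A rotation that hardly moves the averages of [f] is close to trivial, because the rotated
   coefficient has squared modulus at least kappa. *)
have rigid (be : circle R) (de' : R) : 0 <= de' ->
    (forall al, `|T f 0 (al + be) - T f 0 al| <= de') ->
    kappa * (1 - ccos be) <= de' ^+ 2.
  move=> de0 H; have := phase_displacement (C f) (S f) be => /=.
  rewrite -!TE -/q; have := H 0; have := H q; rewrite add0r.
  have := ccos_le1 be.
  set X := T f 0 be - _; set Y := T f 0 (q + be) - _ => c1.
  rewrite -(ler_sqr (x := `|Y|)) ?nnegrE ?normr_ge0 // real_normK ?num_real // => hY.
  rewrite -(ler_sqr (x := `|X|)) ?nnegrE ?normr_ge0 // real_normK ?num_real // => hX.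
  nra.
exists theta; split.
- move=> x y xs ys xys.
  have [i [-> pi_]] := htheta _ xs; have [j [-> pj]] := htheta _ ys.
  have [l [-> pl]] := htheta _ xys.
  have H : kappa * (1 - ccos (th l - th i - th j)) <= (3 * d) ^+ 2.
    apply: rigid => [|al]; first by rewrite mulr_ge0 ?ltW.
    set be := th l - th i - th j.
    (* Shifting by i, by j and back by l closes a loop, since p i + p j = p l; only the rotation by
       [be] and three errors [d] remain. *)
    have h1 := shift_f i 0 (al + be).
    have h2 := shift_f j (0 + p i) (al + be + th i).
    have h3 := shift_f l 0 al.
    have E1 : 0 + p i + p j = 0 + p l by rewrite pi_ pj pl !add0r.
    have E2 : al + be + th i + th j = al + th l.
      by rewrite /be addrAC -(addrA al) subrK -addrA subrK.
    move: h1 h2 h3; rewrite E1 E2 !ler_norml => /andP[? ?] /andP[? ?] /andP[? ?].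
    by apply/andP; split; lra.
  by nra.
- move=> eta x eta0 xs Ux; have [i [-> pi_]] := htheta _ xs.
  have [nU fU] := hU _ eta0.
  set m := Num.min 1 (kappa * eta / 2) in fU.
  have [m1 m2] : m <= 1 /\ m <= kappa * eta / 2 by split; rewrite /m ge_min lexx ?orbT.
  have m0 : 0 <= m by apply: le_trans (ltW (fU 0 x Ux)).
  have H : kappa * (1 - ccos (th i)) <= (d + m) ^+ 2.
    apply: rigid => [|al]; first by rewrite addr_ge0 // ltW.
    have h1 := shift_f i 0 al.
    have h2 : `|T f (0 + x) (al + th i) - T f 0 (al + th i)| <= m.
      by apply: twisted_translate => z; exact/ltW/fU.
    move: h1 h2; rewrite pi_ !ler_norml => /andP[? ?] /andP[? ?].
    by apply/andP; split; lra.
  have : (d + m) ^+ 2 <= 2 * d + 2 * m by nra.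
  by nra.
move=> as_; have [i [-> pi_]] := htheta _ as_.
(* Here [p i = a], so the average of [f] is that of [v] minus its translate by [a], that is, up to
   [d], minus its rotation by - th i. If th i were near 0 this would be too small for the lower
   bound kappa; the constants give 1 - ccos (th i) >= kappa / 16. *)
have Tf al : T f 0 al = T v 0 al - T v (0 + p i) al.
  rewrite /T /twisted -mulrBl -sumrB pi_; congr (_ / _); apply: eq_bigr => y _.
  by rewrite /f mulrBl !add0r (addrC a).
have near al : `|T f 0 al - (T v 0 al - T v 0 (al - th i))| <= d.
  have := shift_v i 0 (al - th i); rewrite subrK Tf !ler_norml => /andP[? ?].
  by apply/andP; split; lra.
have := phase_displacement (C v) (S v) (- th i) => /=.
rewrite -!TE -/q ccosN; have := near 0; have := near q; rewrite sub0r.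
have Cv : `|C v| <= 1.
  apply: average_normr_le1 => y; rewrite normrM mulr_ile1 ?normr_ccos_le1 //.
  by have /andP[? ?] := v01 (0 + p y); rewrite ger0_norm.
have Sv : `|S v| <= 1.
  apply: average_normr_le1 => y; rewrite normrM mulr_ile1 //.
    by have /andP[? ?] := v01 (0 + p y); rewrite ger0_norm.
  by rewrite ler_norml /csin sin_le1 sin_geN1.
have E0 : T f 0 0 = C f by rewrite TE ccos0 csin0; ring.
have Eq : T f 0 q = - S f by rewrite TE /q ccos_quarter csin_quarter; ring.
have c1 := ccos_le1 (th i).
have CS : C v ^+ 2 + S v ^+ 2 <= 2.
  by move: Cv Sv; rewrite !ler_norml => /andP[? ?] /andP[? ?]; nra.
rewrite E0 Eq; move: lbk.
set X := T v 0 (- th i) - T v 0 0; set Y := T v 0 (q - th i) - T v 0 q.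
rewrite -(opprB (T v 0 (- th i)) (T v 0 0)) -(opprB (T v 0 (q - th i)) (T v 0 q)) -/X -/Y.
rewrite !opprK !ler_norml => lbk /andP[h1 h2] /andP[h3 h4] hXY.
have h5 : S f ^+ 2 <= 2 * Y ^+ 2 + 2 * d ^+ 2.
  have : (Y - S f) ^+ 2 <= d ^+ 2 by nra.
  have := sqr_ge0 (2 * Y - S f); nra.
have h6 : C f ^+ 2 <= 2 * X ^+ 2 + 2 * d ^+ 2.
  have : (C f + X) ^+ 2 <= d ^+ 2 by nra.
  have := sqr_ge0 (2 * X + C f); nra.
have h7 : d ^+ 2 <= kappa / 8 by nra.
have : X ^+ 2 + Y ^+ 2 <= 4 * (1 - ccos (th i)).
  rewrite hXY; nra.
by nra.
Qed.
End Characters.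

Lemma closed_all (X : topologicalType) (I : Type) (P : I -> set X) :
  (forall i, closed (P i)) -> closed [set x | forall i, P i x].
Proof.
move=> cP; rewrite (_ : [set x | _] = \bigcap_(i in setT) P i).
  by apply: closed_bigI => i _; exact: cP.
by rewrite eqEsubset; split => x h //= i; exact: h.
Qed.

Lemma closed_imply (X : topologicalType) (Q : Prop) (P : set X) :
  closed P -> closed [set x | Q -> P x].
Proof.
move=> cP; have [q|nq] := pselect Q.
  by rewrite (_ : [set x | _] = P) // eqEsubset; split => x /= h //; exact: h.
rewrite (_ : [set x | _] = setT); first exact: closedT.
by rewrite eqEsubset; split => // x _ /nq.
Qed.

Lemma closed_ge_preimage (R : realType) (X : topologicalType) (u : X -> R) (c : R) :
  continuous u -> closed [set x | c <= u x].
Proof.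
move=> uc; apply: (@closed_comp _ _ u [set y | c <= y]); last exact: closed_ge.
by move=> x _; exact: uc.
Qed.

Lemma closed_le_preimage (R : realType) (X : topologicalType) (u : X -> R) (c : R) :
  continuous u -> closed [set x | u x <= c].
Proof.
move=> uc; apply: (@closed_comp _ _ u [set y | y <= c]); last exact: closed_le.
by move=> x _; exact: uc.
Qed.

Lemma ptws_eval_continuous (I : eqType) (T : topologicalType) (x : I) :
  continuous (fun t : {ptws I -> T} => t x).
Proof. exact: (@proj_continuous I (fun=> T) x). Qed.

Lemma ptws_compact (I : eqType) (T : topologicalType) :
  compact [set: T] -> compact [set: {ptws I -> T}].
Proof.
move=> cT; rewrite (_ : setT = [set f : {ptws I -> T} | forall i, [set: T] (f i)]).
  exact: (@tychonoff I (fun=> T) (fun=> setT)).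
by rewrite eqEsubset; split.
Qed.

Lemma circle_subC_continuous (R : realType) (X : topologicalType)
    (f g : X -> circle R) :
  continuous f -> continuous g -> continuous (fun x => f x - g x).
Proof.
move=> fc gc.
exact: (comp_continuous (pair_continuous fc gc) (@circle_sub_continuous R)).
Qed.

Lemma circle_additive_continuous (R : realType) (G : topologicalZmodType)
    (f : G -> circle R) : additive_map f ->
  (forall e : R, 0 < e -> nbhs 0 [set x | 1 - e < ccos (f x)]) -> continuous f.
Proof.
move=> fD f0 x N /circle_nbhs [e e0 eN].
apply: filterS (nbhs_translate x (f0 _ e0)) => y /=.
by rewrite (additive_mapB _ _ fD); exact: eN.
Qed.

(** The approximate conditions for a finite [s] and an error [e] cut out a nonempty closed set
    [F (s, e)] in the compact space of all maps to the circle. Enlarging [s] and shrinking [e] makes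
    these sets directed; a common point satisfies the conditions for all [s] and [e], hence is a
    character. *)
Theorem characters_separate_points (R : realType) (G : topologicalZmodType) (a : G) :
  compact [set: G] -> hausdorff_space G -> a <> 0 ->
  exists chi : G -> circle R, [/\ additive_map chi, continuous chi & chi a <> 0].
Proof.
move=> cG hG a0; have [c [U [c0 nU H]]] := approximate_character R cG hG a0.
pose X := {ptws G -> circle R}.
pose F (i : seq G * {posnum R}) := [set t : X |
  (forall x, x \in i.1 -> forall y, y \in i.1 -> x + y \in i.1 ->
     1 - i.2%:num <= ccos (t (x + y) - t x - t y)) /\
  (forall eta x, 0 < eta -> x \in i.1 -> U eta x -> 1 - (eta + i.2%:num) <= ccos (t x)) /\
  (a \in i.1 -> ccos (t a) <= 1 - c)].
have evc x : continuous (fun t : X => t x) by exact: ptws_eval_continuous.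
have cc x y : continuous (fun t : X => t (x + y) - t x - t y).
  exact: circle_subC_continuous (circle_subC_continuous (evc _) (evc _)) (evc _).
have [t ht] : exists t, forall i, F i t.
  apply: directed_closed_meet.
  - exact/ptws_compact/circle_compact.
  - by constructor; exact: ([::], 1%:pos).
  - move=> [s e]; apply: closedI; last apply: closedI.
    + do 5! [apply: closed_all => ? || apply: closed_imply].
      apply: closed_ge_preimage.
      exact: comp_continuous (cc _ _) (@ccos_continuous R).
    + do 5! [apply: closed_all => ? || apply: closed_imply].
      apply: closed_ge_preimage.
      exact: comp_continuous (evc _) (@ccos_continuous R).
    + apply: closed_imply.
      apply: closed_le_preimage.
      exact: comp_continuous (evc _) (@ccos_continuous R).
  - move=> [s e]; have [t [t1 t2 t3]] := H s e%:num (gt0 e).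
    by exists t; split => [x xs y ys xys|]; [exact: t1|split].
  - move=> [s e] [s' e']; exists (s ++ s', (Num.min e%:num e'%:num)%:pos).
    move=> t [/= t1 [t2 t3]]; split; split => /=.
    + move=> x xs y ys xys.
      have := t1 x _ y _ _; rewrite !mem_cat xs ys xys => /(_ isT isT isT).
      by apply: le_trans; rewrite lerB // ge_min lexx.
    + split => [eta x eta0 xs Ux|as_]; last by apply: t3; rewrite mem_cat as_.
      have := t2 eta x eta0 _ Ux; rewrite mem_cat xs => /(_ isT).
      by apply: le_trans; rewrite lerB // lerD // ge_min lexx.
    + move=> x xs y ys xys.
      have := t1 x _ y _ _; rewrite !mem_cat xs ys xys !orbT => /(_ isT isT isT).
      by apply: le_trans; rewrite lerB // ge_min lexx orbT.
    + split => [eta x eta0 xs Ux|as_]; last by apply: t3; rewrite mem_cat as_ orbT.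
      have := t2 eta x eta0 _ Ux; rewrite mem_cat xs orbT => /(_ isT).
      by apply: le_trans; rewrite lerB // lerD // ge_min lexx orbT.
have tD : additive_map t.
  move=> x y; apply: subr0_eq; rewrite opprD addrA; apply: ccos_eq1; apply/eqP.
  rewrite eq_le ccos_le1 /=; apply/ler_addgt0Pr => e e0.
  have [h _] := ht ([:: x; y; x + y], PosNum e0).
  have := h x _ y _ _; rewrite /= !inE !eqxx !orbT => /(_ isT isT isT); lra.
have t0 : t 0 = 0 by exact: additive_map0.
exists t; split => //.
  apply: circle_additive_continuous => // e e0.
  have e3 : 0 < e / 3 by rewrite divr_gt0.
  apply: filterS (nU _ e3) => x Ux /=.
  have [_ [h _]] := ht ([:: x], PosNum e3).
  have := h _ _ e3 _ Ux; rewrite /= inE eqxx => /(_ isT); lra.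
move=> ta; have [_ [_ h]] := ht ([:: a], 1%:pos).
by have := h; rewrite /= inE eqxx ta ccos0 => /(_ isT); lra.
Qed.

(** * Direct factors *)

Section Subgroup.
Variables (G : topologicalZmodType) (P : set G).

Definition subgroup_set := P 0 /\ forall x y, P x -> P y -> P (x - y).

(** The proof that [P] is a subgroup is an argument, so that the algebraic structures can be
    inferred from the type [subgroup hP] alone. *)
Definition subgroup_pred of subgroup_set : {pred G} := fun x => `[< P x >].

Definition subgroup (hP : subgroup_set) : Type := {x : G | subgroup_pred hP x}.

Variable hP : subgroup_set.

Lemma subgroup_pred_zmod_closed : zmod_closed (subgroup_pred hP).
Proof.
have [P0 PB] := hP; split => [|x y]; first exact/asboolP.
by rewrite !inE => Px Py; exact: PB.
Qed.

HB.instance Definition _ :=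
  GRing.isZmodClosed.Build G (subgroup_pred hP) subgroup_pred_zmod_closed.

HB.instance Definition _ := [isSub of subgroup hP for @sval G (subgroup_pred hP)].
HB.instance Definition _ := [Choice of subgroup hP by <:].
HB.instance Definition _ := [SubChoice_isSubZmodule of subgroup hP by <:].
HB.instance Definition _ :=
  Topological.copy (subgroup hP) (initial_topology (val : subgroup hP -> G)).

Lemma subgroup_valD (x y : subgroup hP) : val (x + y) = val x + val y.
Proof. by []. Qed.

Lemma subgroup_val_continuous : continuous (val : subgroup hP -> G).
Proof. exact: initial_continuous. Qed.

Lemma subgroup_continuous (X : topologicalType) (f : X -> subgroup hP) :
  continuous (val \o f) -> continuous f.
Proof. exact: continuous_comp_initial. Qed.

Lemma subgroup_sub_continuous :
  continuous (fun p : subgroup hP * subgroup hP => p.1 - p.2).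
Proof.
apply: subgroup_continuous; apply: subf_continuous.
  exact: comp_continuous (@fst_continuous _ _) subgroup_val_continuous.
exact: comp_continuous (@snd_continuous _ _) subgroup_val_continuous.
Qed.

HB.instance Definition _ :=
  PreTopologicalNmodule_isTopologicalZmodule.Build (subgroup hP) subgroup_sub_continuous.

Lemma subgroupP (x : subgroup hP) : P (val x).
Proof. by have := valP x; rewrite /subgroup_pred /= => /asboolW. Qed.

Definition to_subgroup (x : G) (Px : P x) : subgroup hP := exist _ x (asboolT Px).

End Subgroup.

Lemma injective_hausdorff (X Y : topologicalType) (f : X -> Y) :
  injective f -> continuous f -> hausdorff_space Y -> hausdorff_space X.
Proof.
move=> fi fc hY x y xy; apply: fi; apply: hY => A B nA nB.
by have [z [Az Bz]] := xy _ _ (fc _ _ nA) (fc _ _ nB); exists (f z).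
Qed.

Lemma image_compact_setT (X Y : topologicalType) (f : X -> Y) :
  continuous f -> (forall y, exists x, f x = y) -> compact [set: X] -> compact [set: Y].
Proof.
move=> fc fs cX; have -> : [set: Y] = f @` setT.
  by rewrite eqEsubset; split => // y _; have [x <-] := fs y; exists x.
by apply: continuous_compact => //; exact: continuous_subspaceT.
Qed.

Lemma image_connected_setT (X Y : topologicalType) (f : X -> Y) :
  continuous f -> (forall y, exists x, f x = y) -> connected [set: X] -> connected [set: Y].
Proof.
move=> fc fs cX; have -> : [set: Y] = f @` setT.
  by rewrite eqEsubset; split => // y _; have [x <-] := fs y; exists x.
by apply: connected_continuous_connected => //; exact: continuous_subspaceT.
Qed.

Section Idempotent.
Variables (K : topologicalZmodType) (e : K -> K).
Hypotheses (eD : additive_map e) (ec : continuous e) (ee : forall x, e (e x) = e x).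

Lemma fixed_subgroup : subgroup_set [set x | e x = x].
Proof. by split => [|x y /= ex ey]; rewrite /= ?additive_map0 // additive_mapB // ex ey. Qed.

Lemma kernel_subgroup : subgroup_set [set x | e x = 0].
Proof. by split => [|x y /= ex ey]; rewrite /= ?additive_map0 // additive_mapB // ex ey subr0. Qed.

Definition fixed_part (x : K) : subgroup fixed_subgroup := to_subgroup fixed_subgroup (ee x).

Lemma idempotent_split : top_iso_prod K (subgroup fixed_subgroup) (subgroup kernel_subgroup).
Proof.
have k0 x : e (x - e x) = 0 by rewrite additive_mapB // ee subrr.
exists (fun x => (fixed_part x, to_subgroup kernel_subgroup (k0 x))).
exists (fun p => val p.1 + val p.2).
split => [x y|].
  congr (_, _); apply: val_inj; rewrite subgroup_valD /= eD //.
  by rewrite opprD addrACA.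
split; first by move=> x /=; rewrite addrC subrK.
split.
  move=> [x y] /=; have /= ex := subgroupP x; have /= ey := subgroupP y.
  by congr (_, _); apply: val_inj; rewrite /= eD ex ey addr0 // addrAC subrr add0r.
split.
  apply: pair_continuous; apply: subgroup_continuous; first exact: ec.
  by apply: subf_continuous; [move=> x; exact: cvg_id|exact: ec].
apply: addf_continuous.
  exact: comp_continuous (@fst_continuous _ _) (@subgroup_val_continuous _ _ _).
exact: comp_continuous (@snd_continuous _ _) (@subgroup_val_continuous _ _ _).
Qed.

(** The fixed points of [e] form a factor, with the kernel as complement, since x = e x + (x - e x).
    This factor is compact and connected as an image of [K], and [b] is a basis of its one-parameter
    subgroups, so it is a solenoid. *)
Lemma idempotent_not_clipped (R : realType) (b : R -> K) :
  compact_group K -> connected [set: K] ->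
  additive_map b -> continuous b -> (forall x, e (b x) = b x) ->
  (forall g : R -> K, additive_map g -> continuous g -> (forall x, e (g x) = g x) ->
     exists! c, forall x, g x = b (c * x)) ->
  ~ clipped R K.
Proof.
move=> [cK hK] connK bD bc eb hb; apply.
exists (subgroup fixed_subgroup), (subgroup kernel_subgroup).
split; last exact: idempotent_split.
have fc : continuous fixed_part by apply: subgroup_continuous; exact: ec.
have fs y : exists x, fixed_part x = y.
  by exists (val y); apply: val_inj; have /= := subgroupP y.
split; first split.
- exact: image_compact_setT fc fs cK.
- exact: injective_hausdorff (@val_inj _ _ (subgroup fixed_subgroup))
    (@subgroup_val_continuous _ _ fixed_subgroup) hK.
split; first exact: image_connected_setT fc fs connK.
exists (fun=> fun x => to_subgroup fixed_subgroup (eb x)); split.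
  move=> _; split; first by move=> x y; apply: val_inj; rewrite /= bD.
  by apply: subgroup_continuous; exact: bc.
move=> g gD gc.
have [|||c [hc uc]] := hb (fun x => val (g x)).
- by move=> x y; rewrite gD subgroup_valD.
- exact: comp_continuous gc (@subgroup_val_continuous _ _ _).
- by move=> x; have /= := subgroupP (g x).
exists (fun=> c); split.
  by move=> x; rewrite big_ord1; apply: val_inj => /=; rewrite hc.
move=> c' hc'; apply/funext => i; rewrite (ord1 i); apply: uc => x.
by rewrite hc' big_ord1.
Qed.
End Idempotent.

(** * Splitting off a circle *)

Section CircleHoms.
Variable R : realType.
Local Notation T := (circle R).

Lemma ccos_near0 (X : topologicalType) (f : X -> T) (x : X) (e : R) :
  {for x, continuous f} -> f x = 0 -> e < 1 -> nbhs x [set y | e < ccos (f y)].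
Proof.
move=> fx fx0 e1; have H : {for x, continuous (@ccos R \o f)}.
  by apply: continuous_comp => //; exact: ccos_continuous.
by apply: (H [set r | e < r]); rewrite /= fx0 ccos0; exact: lt_nbhsr.
Qed.

Lemma cpi_small_inj (x y : R) : `|x - y| < 1 -> cpi x = cpi y -> x = y.
Proof.
move=> xy /cpi_eqP /intrP [m hm]; apply/subr0_eq; rewrite hm.
move: xy; rewrite hm -intr_norm -[1]/(1%:~R) ltr_int.
by case: m {hm} => [[|n]|n] //.
Qed.

Lemma cpi_scale_inj (c c' : R) : (forall x, cpi (c * x) = cpi (c' * x)) -> c = c'.
Proof.
move=> H; pose y := (1 + `|c - c'|)^-1.
have p0 : 0 < 1 + `|c - c'| by rewrite ltr_pwDl.
have y0 : 0 < y by rewrite invr_gt0.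
apply: (mulIf (lt0r_neq0 y0)); apply: cpi_small_inj (H y).
rewrite -mulrBl normrM (gtr0_norm y0) /y ltr_pdivrMr // mul1r; lra.
Qed.

Lemma mulrl_continuous (c : R) : continuous (fun x : R => c * x).
Proof. by move=> x; apply: continuousM; [exact: cst_continuous|exact: id]. Qed.

Lemma mulrr_continuous (c : R) : continuous (fun x : R => x * c).
Proof. by move=> x; apply: continuousM; [exact: id|exact: cst_continuous]. Qed.

(* On dyadic fractions of a small [D], [g] has a unique small lift, which halves
   when its argument does. *)
Lemma circle_hom_linear (g : R -> T) : additive_map g -> continuous g ->
  exists c, forall x, g x = cpi (c * x).
Proof.
move=> gD gc.
have g0 := additive_map0 gD.
(* The radius 1/8 keeps lifts unique even after doubling: 2u and another lift differ by less than
   3/8 < 1. *)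
have q1 : cos (2 * pi * 8^-1) < 1 :> R.
  have := pi_gt0 R; set p := pi => p0.
  by rewrite -[X in _ < X]cos0 ltr_cos ?in_itv /=; lra.
have /nbhs_ballP [d /= d0 hd] := ccos_near0 (gc 0) g0 q1.
have lift x : `|x| < d -> exists2 u : R, `|u| < 8^-1 & g x = cpi u.
  move=> xd; apply: ccos_gt; first by lra.
  by apply: hd; rewrite /ball /= sub0r normrN.
pose D := d / 2.
have D0 : 0 < D by rewrite divr_gt0.
have [t0 ht0 gt0] : exists2 u : R, `|u| < 8^-1 & g D = cpi u.
  by apply: lift; rewrite gtr0_norm // /D; lra.
have dy n : g (D / 2 ^+ n) = cpi (t0 / 2 ^+ n) /\ `|t0 / 2 ^+ n| < 8^-1.
  elim: n => [|n [IH IHn]]; first by rewrite expr0 !divr1.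
  have p2 : 0 < 2 ^+ n :> R by rewrite exprn_gt0.
  have [u hu gu] : exists2 u : R, `|u| < 8^-1 & g (D / 2 ^+ n.+1) = cpi u.
    apply: lift; rewrite gtr0_norm ?divr_gt0 ?exprn_gt0 //.
    rewrite ltr_pdivrMr ?exprn_gt0 // /D.
    have : 1 <= 2 ^+ n.+1 :> R by rewrite exprn_ege1 // ler1n.
    nra.
  have E : u = t0 / 2 ^+ n.+1.
    have E2 : u + u = t0 / 2 ^+ n.
      apply: cpi_small_inj; last first.
        rewrite cpiD -gu -gD -IH; congr g; rewrite exprS; field.
        by rewrite lt0r_neq0.
      move: hu IHn; rewrite !ltr_norml => /andP[? ?] /andP[? ?].
      by apply/andP; split; lra.
    rewrite exprS invfM mulrCA -E2; lra.
  by rewrite gu -E; split.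
exists (t0 / D) => x; apply: subr0_eq.
(* The difference [h] is continuous and kills D / 2^n for all n, hence all multiples of arbitrarily
   small steps, and so vanishes. *)
pose h y := g y - cpi (t0 / D * y).
have hD : additive_map h.
  by move=> y z; rewrite /h gD mulrDr cpiD opprD addrACA.
have hc : continuous h.
  apply: circle_subC_continuous => //.
  apply: comp_continuous (@cpi_continuous R).
  exact: mulrl_continuous.
have h2 n : h (D / 2 ^+ n) = 0.
  rewrite /h (dy n).1; apply/eqP; rewrite subr_eq0; apply/eqP; congr cpi.
  by field; rewrite lt0r_neq0 ?exprn_gt0 // lt0r_neq0.
rewrite -/(h x); apply: ccos_eq1; apply/eqP; rewrite eq_le ccos_le1 /=.
apply/ler_addgt0Pr => e e0.
have e1 : 1 - e < 1 by lra.
have /nbhs_ballP [eta /= eta0 heta] := ccos_near0 (hc 0) (additive_map0 hD) e1.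
have [n hn] : exists n, D / 2 ^+ n < eta.
  exists (Num.bound (D / eta)); set n := Num.bound _.
  have hn : D / eta < n%:R by apply: archi_boundP; rewrite ltW ?divr_gt0.
  have n2 : n%:R <= 2 ^+ n :> R by rewrite -natrX ler_nat ltnW // ltn_expl.
  rewrite ltr_pdivrMr ?exprn_gt0 // mulrC -ltr_pdivrMr //.
  exact: lt_le_trans n2.
set s := D / 2 ^+ n in hn.
have s0 : 0 < s by rewrite divr_gt0 ?exprn_gt0.
have := real_floor_itv (num_real (x / s)).
set k := Num.floor (x / s) => /andP[k1 k2].
have hk : h (s *~ k) = 0.
  have : h s = 0 by exact: h2.
  case: (k) => m hs0; first by rewrite -pmulrn (additive_mapMn _ _ hD) hs0 mul0rn.
  by rewrite NegzE mulrNz -pmulrn (additive_mapN _ hD) (additive_mapMn _ _ hD) hs0 mul0rn oppr0.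
have -> : h x = h (x - s *~ k) by rewrite (additive_mapB _ _ hD) hk subr0.
rewrite -lerBlDr ltW //; apply: heta; rewrite /ball /= sub0r normrN.
move: k1 k2; rewrite ler_pdivlMr // ltr_pdivrMr // intrD => k1 k2.
rewrite -mulrzr ltr_norml; apply/andP; split; lra.
Qed.

Lemma circle_endo (f : T -> T) : additive_map f -> continuous f ->
  exists m : int, forall x, f (cpi x) = cpi (m%:~R * x).
Proof.
move=> fD fc.
have [||c hc] := @circle_hom_linear (fun x => f (cpi x)).
- by move=> x y; rewrite cpiD fD.
- exact: comp_continuous (@cpi_continuous R) fc.
have /intrP [m hm] : c \is a Num.int.
  apply/cpi_eq0; rewrite -[c]mulr1 -hc; have -> : cpi (1 : R) = 0 by apply/cpi_eq0/rpred1.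
  exact: additive_map0.
by exists m => x; rewrite hc hm.
Qed.

Definition character (K : topologicalZmodType) (chi : K -> T) :=
  additive_map chi /\ continuous chi.

Lemma characterB (K : topologicalZmodType) (chi psi : K -> T) :
  character chi -> character psi -> character (fun x => chi x - psi x).
Proof.
move=> [cD cc] [pD pc]; split; last exact: circle_subC_continuous.
by move=> x y; rewrite cD pD opprD addrACA.
Qed.

Lemma character0 (K : topologicalZmodType) : character ((fun=> 0) : K -> T).
Proof. by split => [x y|x]; [rewrite addr0|exact: cvg_cst]. Qed.

(** The degrees of characters along [f] form a subgroup of Z, nonzero because characters separate
    points, so all are multiples of the least positive one [d]. Hence every character kills f(1/d),
    which is therefore 0. *)
Lemma character_min_degree (K : topologicalZmodType) (f : T -> K) :
  compact_group K -> additive_map f -> continuous f -> (exists x, f x <> 0) ->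
  exists (d : nat) (chi : K -> T), [/\ (0 < d)%N, character chi,
    forall x, chi (f (cpi x)) = cpi (d%:R * x) & f (cpi (d%:R^-1)) = 0].
Proof.
move=> [cK hK] fD fc [x0 fx0].
pose deg (m : int) := exists2 chi : K -> T, character chi &
   forall x, chi (f (cpi x)) = cpi (m%:~R * x).
have degB m m' : deg m -> deg m' -> deg (m - m').
  move=> [c hc cE] [c' hc' c'E]; exists (fun x => c x - c' x); first exact: characterB.
  by move=> x; rewrite cE c'E intrD mulrNz mulrDl mulNr cpiB.
have deg0 : deg 0.
  by exists (fun=> 0); [exact: character0|move=> x; rewrite mul0r cpi0].
have degN m : deg m -> deg (- m) by move=> dm; rewrite -sub0r; exact: degB.
have degabs m : deg m -> deg `|m|%N.
  by case: (intP m) => // n dm; rewrite ?absz_nat // abszN /=; have := degN _ dm; rewrite opprK.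
have degsep y : f y <> 0 -> exists m chi, [/\ character chi, chi (f y) <> 0 &
    forall x, chi (f (cpi x)) = cpi (m%:~R * x)].
  move=> fy; have [chi [cD cc cf]] := characters_separate_points R cK hK fy.
  have [||m hm] := @circle_endo (fun t => chi (f t)).
  - by move=> s t; rewrite fD cD.
  - exact: comp_continuous fc cc.
  by exists m, chi.
have exd : exists n, (0 < n)%N && `[< deg n >].
  have [m [chi [cc cf cE]]] := degsep _ fx0.
  exists `|m|%N; rewrite absz_gt0; apply/andP; split.
    apply/eqP => m0; apply: cf; have [x ->] := cpi_surj x0.
    by rewrite cE m0 mul0r cpi0.
  by apply: asboolT; apply: degabs; exists chi.
case: (ex_minnP exd) => d /andP[d0 /asboolW [chi hchi chiE]] dmin.
have ddvd (n : nat) : deg n -> (d %| n)%N.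
  elim/ltn_ind: n => n IH dn; have [nd|dn'] := ltnP n d.
    case: n nd dn {IH} => [//|n] nd dn; have := dmin n.+1; rewrite /= leqNgt nd.
    by move=> H; exfalso; move: H; rewrite (asboolT dn) => /(_ isT).
  rewrite -(subnK dn') dvdn_addl //; apply: IH.
    by rewrite ltn_subrL d0 (leq_trans d0 dn').
  by rewrite -subzn //; apply: degB => //; exists chi.
exists d, chi; split => //; apply: contrapT => fd.
have [m [psi [pc pf pE]]] := degsep _ fd.
apply: pf; rewrite pE; apply/cpi_eq0.
have : (d %| `|m|)%N by apply: ddvd; apply: degabs; exists psi.
move=> dm; have : (d%:Z %| m)%Z by rewrite dvdzE.
move=> /dvdzP [k ->]; rewrite intrM -mulrA divff ?mulr1 ?intr_int //.
by rewrite pnatr_eq0 -lt0n.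
Qed.

Lemma circle_factor (K : topologicalZmodType) (f : T -> K) :
  compact_group K -> additive_map f -> continuous f -> (exists x, f x <> 0) ->
  exists (s : T -> K) (r : K -> T), [/\ additive_map s, continuous s, character r
    & forall t, r (s t) = t].
Proof.
move=> cK fD fc fx; have [d [chi [d0 hchi chiE fd]]] := character_min_degree cK fD fc fx.
have dn0 : d%:R != 0 :> R by rewrite pnatr_eq0 -lt0n.
(* [s] is [f] after division by [d]; the choice of representative does not matter because [f] kills
   1/d. *)
pose s (t : T) := f (cpi (repr t / d%:R)).
have sE x : s (cpi x) = f (cpi (x / d%:R)).
  have /intrP[m hm] : repr (cpi x) - x \is a Num.int by apply/cpi_eqP; rewrite cpi_repr.
  have -> : s (cpi x) = f (cpi (x / d%:R)) + f (cpi (d%:R^-1 *~ m)).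
    by rewrite -fD -cpiD /s; congr (f (cpi _)); rewrite -mulrzr mulrC -hm; field.
  rewrite (_ : f (cpi (d%:R^-1 *~ m)) = 0) ?addr0 //.
  case: (m) => n; first by rewrite -pmulrn cpiMn (additive_mapMn _ _ fD) fd mul0rn.
  rewrite NegzE mulrNz -pmulrn cpiN cpiMn (additive_mapN _ fD).
  by rewrite (additive_mapMn _ _ fD) fd mul0rn oppr0.
exists s, chi; split => //.
- move=> t u; have [x ->] := cpi_surj t; have [y ->] := cpi_surj u.
  by rewrite -cpiD !sE mulrDl cpiD fD.
- apply/(@quotient_continuous (Rtop R) (Quotient.quot (intZ R))).
  rewrite (_ : _ \o _ = (fun x => f (cpi (x / d%:R)))); last first.
    by apply/funext => x; exact: sE.
  apply: comp_continuous fc; apply: comp_continuous (@cpi_continuous R).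
  exact: mulrr_continuous.
- move=> t; have [x ->] := cpi_surj t.
  by rewrite sE chiE mulrCA divff // mulr1.
Qed.

(** The idempotent x -> s (r x) fixes exactly the image of [s], and [r] turns one-parameter
    subgroups there into homomorphisms from R to the circle, which are linear modulo 1. *)
Lemma circle_not_clipped (K : topologicalZmodType) :
  compact_group K -> connected [set: K] -> ~ cHom_circle_trivial R K -> ~ clipped R K.
Proof.
move=> cK connK /existsNP [f] /not_implyP [fD] /not_implyP [fc] /existsNP fx.
have [s [r [sD sc [rD rc] rs]]] := circle_factor cK fD fc fx.
apply: (@idempotent_not_clipped K (fun x => s (r x)) _ _ _ R (fun x => s (cpi x))) => //.
- by move=> x y; rewrite rD sD.
- exact: comp_continuous rc sc.
- by move=> x; rewrite rs.
- by move=> x y; rewrite cpiD sD.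
- exact: comp_continuous (@cpi_continuous R) sc.
- by move=> x; rewrite rs.
move=> g gD gc eg.
have [||c hc] := @circle_hom_linear (fun x => r (g x)).
- by move=> x y; rewrite gD rD.
- exact: comp_continuous gc rc.
exists c; split; first by move=> x; rewrite -eg hc.
move=> c' hc'; apply: cpi_scale_inj => x.
by rewrite -hc hc' rs.
Qed.
End CircleHoms.

(** * Splitting off the dual of the rationals *)

Lemma prod_continuous (I : Type) (T : I -> topologicalType) (X : topologicalType)
    (g : X -> prod_topology T) :
  (forall i, continuous (fun x => g x i)) -> continuous g.
Proof.
move=> gc x; apply/cvg_sup => i U [V [[W oW <-] Wx] VU].
by apply: filterS VU _; apply: (gc i x W); exact: open_nbhs_nbhs.
Qed.

(** * Closed subgroups of the circle *)

Section CircleSubgroups.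
Variable R : realType.
Local Notation T := (circle R).
Variable H : set T.
Hypotheses (Hs : H 0 /\ forall x y, H x -> H y -> H (x - y)).

Lemma circle_subgroup_mulrn t n : H t -> H (t *+ n).
Proof.
have [H0 Hsub] := Hs; move=> Ht; elim: n => [|n IH]; first by rewrite mulr0n.
by rewrite mulrS -[t *+ n]opprK; apply: (Hsub) => //; rewrite -sub0r; exact: Hsub.
Qed.

Lemma circle_subgroup_mulrz t m : H t -> H (t *~ m).
Proof.
have [H0 Hsub] := Hs; move=> Ht; case: m => n; first exact: circle_subgroup_mulrn.
by rewrite NegzE mulrNz -sub0r; apply: Hsub => //; exact: circle_subgroup_mulrn.
Qed.

Lemma cpi_mulrz (x : R) m : cpi (x *~ m) = cpi x *~ m.
Proof. by case: m => n; rewrite ?NegzE ?mulrNz -!pmulrn ?cpiN cpiMn. Qed.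

(** The multiples of x come within |x| of any real y, so arbitrarily small nonzero elements make [H]
    dense. *)
Lemma circle_subgroup_dense : closed H ->
  (forall d : R, 0 < d -> exists2 x, 0 < `|x| < d & H (cpi x)) ->
  forall t, H t.
Proof.
move=> Hc Hsmall t; have [y ->] := cpi_surj t.
apply: Hc => N /circle_nbhs [e e0 eN].
have e1 : 1 - e < 1 by lra.
have /nbhs_ballP [d /= d0 hd] := ccos_near0 (@cpi_continuous R 0) (@cpi0 R) e1.
have [x /andP[x0 xd] Hx] := Hsmall _ d0.
have {x0} x0 : x != 0 by rewrite -normr_gt0.
exists (cpi (x *~ Num.floor (y / x))); split.
  by rewrite cpi_mulrz; exact: circle_subgroup_mulrz.
apply: eN; rewrite -cpiB; apply: hd; rewrite /ball /= sub0r normrN.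
have := real_floor_itv (num_real (y / x)); rewrite intrD; set k := Num.floor _ => /andP[k1 k2].
apply: le_lt_trans xd; have -> : x *~ k - y = x * (k%:~R - y / x).
  by rewrite -mulrzr; field.
by rewrite normrM ger_pMr ?normr_gt0 // ler_norml; lra.
Qed.

(** Of the M + 1 multiples of t from 0 to M, two have representatives in the same interval of length
    1/M < d, so a positive multiple at most M vanishes, and with it the multiple by M!. *)
Lemma circle_subgroup_exponent (d : R) : 0 < d ->
  (forall x, `|x| < d -> H (cpi x) -> cpi x = 0) ->
  exists2 N, (0 < N)%N & forall t, H t -> t *+ N = 0.
Proof.
move=> d0 Hd; pose M := Num.bound d^-1.
have M0 : d^-1 < M%:R by apply: archi_boundP; rewrite invr_ge0 ltW.
have Mp : 0 < M%:R :> R by apply: lt_trans M0; rewrite invr_gt0.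
exists M`!; first exact: fact_gt0.
move=> t Ht.
have /boolp.choice [x hx] : forall j : nat, exists x, 0 <= x < 1 /\ t *+ j = cpi x.
  by move=> j; have [x x01 E] := cpi_rep (t *+ j); exists x.
have bnd (j : nat) : (`|Num.floor (x j * M%:R)|%N < M)%N.
  have [/andP[x0 x1] _] := hx j.
  have f0 : 0 <= Num.floor (x j * M%:R) by rewrite floor_ge0 mulr_ge0 // ltW.
  rewrite -ltz_nat gez0_abs // -(ltr_int R); apply: le_lt_trans (floor_le_tmp _) _.
  by rewrite -[X in _ < X]mul1r ltr_pM2r.
pose f (j : 'I_M.+1) := Ordinal (bnd j).
have /injectivePn [k [l kl fkl]] : ~~ injectiveb f.
  by apply/negP => /injectiveP /leq_card; rewrite !card_ord ltnn.
wlog lk : k l kl fkl / (l < k)%N.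
  move=> HH; have := kl; rewrite neq_ltn => /orP[lk|lk]; last exact: (HH k l).
  by apply: (HH l k) => //; rewrite eq_sym.
have tkl : t *+ (k - l) = 0.
  have E : t *+ (k - l) = cpi (x k - x l).
    by rewrite mulrnBr ?(ltnW lk) // (hx k).2 (hx l).2 cpiB.
  rewrite E; apply: Hd; last by rewrite -E; exact: circle_subgroup_mulrn.
  have /(congr1 val) /= F := fkl.
  have [/andP[xk0 _] _] := hx k; have [/andP[xl0 _] _] := hx l.
  have fk0 : 0 <= Num.floor (x k * M%:R) by rewrite floor_ge0 mulr_ge0 // ltW.
  have fl0 : 0 <= Num.floor (x l * M%:R) by rewrite floor_ge0 mulr_ge0 // ltW.
  have {}F : Num.floor (x k * M%:R) = Num.floor (x l * M%:R).
    by rewrite -(gez0_abs fk0) -(gez0_abs fl0) F.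
  have := real_floor_itv (num_real (x k * M%:R)).
  have := real_floor_itv (num_real (x l * M%:R)).
  rewrite F intrD => /andP[a1 a2] /andP[b1 b2].
  have : `|(x k - x l) * M%:R| < 1 by rewrite mulrBl ltr_norml; lra.
  rewrite normrM (gtr0_norm Mp) -ltr_pdivlMr // mul1r => /lt_trans; apply.
  by rewrite invf_plt ?posrE.
have /dvdnP [c ->] : (k - l %| M`!)%N.
  by apply: dvdn_fact; rewrite subn_gt0 lk /= (leq_trans (leq_subr _ _)) // -ltnS.
by rewrite mulnC mulrnA tkl mul0rn.
Qed.

Lemma circle_subgroup_dichotomy : closed H ->
  (forall t, H t) \/ exists d : R, 0 < d /\ forall x, `|x| < d -> H (cpi x) -> x = 0.
Proof.
move=> Hc; have [h|/existsNP [d /not_implyP [d0 h]]] :=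
  pselect (forall d : R, 0 < d -> exists2 x, 0 < `|x| < d & H (cpi x)).
  by left; exact: circle_subgroup_dense.
right; exists d; split => // x xd Hx; apply/eqP; apply: contrapT => /negP x0.
by apply: h; exists x => //; rewrite normr_gt0 x0.
Qed.

End CircleSubgroups.

(** The image is a compact subgroup of the circle. If proper, it meets a neighbourhood of 0 only in
    0, so the kernel is open as well as closed, hence all of [K]. *)
Lemma connected_character_surjective (R : realType) (K : topologicalZmodType)
    (chi : K -> circle R) :
  compact [set: K] -> connected [set: K] -> character chi ->
  (exists k, chi k <> 0) -> forall t, exists k, chi k = t.
Proof.
move=> cK connK [cD cc] [k0 ck0].
pose H := [set t | exists k, chi k = t].
have Hs : H 0 /\ forall x y, H x -> H y -> H (x - y).
  split; first by exists 0; exact: additive_map0.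
  by move=> _ _ [x <-] [y <-]; exists (x - y); exact: additive_mapB.
have HE : H = chi @` setT.
  by rewrite eqEsubset; split => [t [k <-]|t [k _ <-]]; exists k.
have Hc : closed H.
  apply: compact_closed; first exact: circle_hausdorff.
  by rewrite HE; apply: continuous_compact => //; exact: continuous_subspaceT.
have [//|[d [d0 hd]]] := circle_subgroup_dichotomy Hs Hc.
exfalso; apply: ck0.
pose Z := [set k | chi k = 0].
have ZE : Z = setT; last by have : Z k0 by rewrite ZE.
have Zopen : open Z.
  rewrite openE => k /= Zk.
  have m0 : 0 < Num.min d 2^-1 by rewrite lt_min d0 invr_gt0 /=.
  have m2 : 0 <= Num.min d 2^-1 <= 2^-1 by rewrite ltW //= ge_min lexx orbT.
  have c1 : cos (2 * pi * Num.min d 2^-1) < 1 :> R.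
    have := pi_gt0 R; set p := pi => p0; rewrite -[X in _ < X]cos0 ltr_cos ?in_itv /=; nra.
  apply: filterS (ccos_near0 (cc k) Zk c1) => z /= /(ccos_gt m2) [x xm E].
  rewrite /Z /= E (hd x) ?cpi0 //.
    by apply: lt_le_trans xm _; rewrite ge_min lexx.
  by exists z.
apply: connK; first by exists 0; exact: additive_map0.
  by exists Z => //; rewrite setTI.
exists Z; last by rewrite setTI.
rewrite (_ : Z = [set k | 1 <= ccos (chi k)]).
  by apply: closed_ge_preimage; exact: comp_continuous cc (@ccos_continuous R).
rewrite eqEsubset; split => k /=; first by rewrite /Z /= => ->; rewrite ccos0.
by move=> h; apply: ccos_eq1; apply/eqP; rewrite eq_le ccos_le1.
Qed.

(** * Homomorphisms onto the dual of the rationals *)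

Section RationalSolenoid.
Variables (R : realType) (K : topologicalZmodType).
Local Notation T := (circle R).
Hypotheses (cK : compact [set: K]) (hK : hausdorff_space K) (connK : connected [set: K]).
Variable f : K -> {ptws rat -> T}.
Hypotheses (fq : forall k, additive_map (fun q : rat => f k q))
  (fD : forall k k' q, f (k + k') q = f k q + f k' q)
  (fc : continuous f).
Variables (k0 : K) (q0 : rat).
Hypothesis fk0 : f k0 q0 <> 0.

Let fqc q : character (fun k => f k q).
Proof.
split; first by move=> k k'; exact: fD.
exact: comp_continuous fc (@ptws_eval_continuous _ T q).
Qed.

Let fqB q k k' : f (k - k') q = f k q - f k' q.
Proof. exact: additive_mapB (fqc q).1. Qed.

Lemma rat_additive_mulrn (h : rat -> T) n q : additive_map h -> h (q / n.+1%:R) *+ n.+1 = h q.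
Proof.
move=> hD; rewrite -(additive_mapMn _ _ hD) -[X in h X = _]mulr_natr.
by rewrite divfK // pnatr_eq0.
Qed.

Lemma rat_additive_eq (h h' : rat -> T) : additive_map h -> additive_map h' ->
  (forall n, h (n.+1%:R^-1) = h' (n.+1%:R^-1)) -> forall q, h q = h' q.
Proof.
move=> hD h'D hh q; pose d := (absz (denq q)).-1.
have dE : denq q = d.+1 :> int by rewrite /d prednK ?absz_gt0 ?denq_neq0 // gez0_abs ?denq_ge0.
have -> : q = (d.+1%:R^-1) *~ numq q.
  by rewrite -mulrzr mulrC -[LHS]divq_num_den dE.
case: (numq q) => n; first by rewrite -!pmulrn (additive_mapMn _ _ hD) (additive_mapMn _ _ h'D) hh.
rewrite NegzE !mulrNz -!pmulrn (additive_mapN _ hD) (additive_mapN _ h'D).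
by rewrite (additive_mapMn _ _ hD) (additive_mapMn _ _ h'D) hh.
Qed.

(** A nonzero evaluation would be onto the circle, yet all its values are killed by n + 1, and 1 /
    (n + 2) is not. *)
Lemma evaluation_div_trivial q n :
  (forall k, f k q = 0) -> forall k, f k (q / n.+1%:R) = 0.
Proof.
move=> fz; apply: contrapT => /existsNP fnz.
have [k hk] := connected_character_surjective cK connK (fqc _) fnz
  (cpi ((n.+2%:R : R)^-1)).
have := rat_additive_mulrn n q (fq k); rewrite hk fz -cpiMn => /cpi_eq0 /intrP [m hm].
have n0 : n.+2%:R != 0 :> R by rewrite pnatr_eq0.
have : (n.+1%:R = m%:~R * n.+2%:R :> R) by rewrite -hm -mulr_natr; field.
move=> E; have {}E : n.+1%:Z = m * n.+2%:Z.
  by apply/eqP; rewrite -(eqr_int R) intrM; apply/eqP.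
case: m {hm} E => [[|k']|k']; lia.
Qed.

Lemma evaluation_surjective q : q != 0 -> forall t, exists k, f k q = t.
Proof.
move=> qn0; apply: (connected_character_surjective cK connK (fqc q)).
apply: contrapT => /forallNP h.
have fz k : f k q = 0 by apply: contrapT; exact: h.
pose r := q0 / q; pose d := (absz (denq r)).-1.
have dE : denq r = d.+1 :> int by rewrite /d prednK ?absz_gt0 ?denq_neq0 // gez0_abs ?denq_ge0.
have E : q0 = (q / d.+1%:R) *~ numq r.
  have -> : q0 = q * r by rewrite /r mulrC divfK.
  by rewrite -mulrzr -[in LHS](divq_num_den r) dE; ring.
apply: fk0; rewrite E; have fz' := evaluation_div_trivial d fz k0.
case: (numq r) => n; first by rewrite -pmulrn (additive_mapMn _ _ (fq k0)) fz' mul0rn.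
rewrite NegzE mulrNz -pmulrn (additive_mapN _ (fq k0)).
by rewrite (additive_mapMn _ _ (fq k0)) fz' mul0rn oppr0.
Qed.

Lemma eval_eq_closed (X : topologicalType) (u : X -> T) t :
  continuous u -> closed [set x | u x = t].
Proof.
move=> uc; rewrite (_ : [set x | _] = [set x | 1 <= ccos (u x - t)]).
  apply: closed_ge_preimage; apply: comp_continuous (@ccos_continuous R).
  by apply: circle_subC_continuous => // x; exact: cvg_cst.
rewrite eqEsubset; split => x /=; first by move=> ->; rewrite subrr ccos0.
by move=> h; apply: subr0_eq; apply: ccos_eq1; apply/eqP; rewrite eq_le ccos_le1.
Qed.

(** A homomorphism on Q is determined by its values at the 1 / (n + 1). Each single value can be
    matched, the condition at a multiple of n + 1 implies the one at n + 1, and compactness meets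
    all conditions at once. *)
Lemma dual_surjective (psi : rat -> T) : additive_map psi ->
  exists k, forall q, f k q = psi q.
Proof.
move=> psiD.
pose C (n : nat) := [set k | f k (n.+1%:R^-1) = psi (n.+1%:R^-1)].
have Cdvd n m : (n.+1 %| m.+1)%N -> C m `<=` C n.
  move=> /dvdnP [c hc] k; rewrite /C /= => hk.
  have c0 : c%:R != 0 :> rat by rewrite pnatr_eq0; case: c hc.
  have -> : n.+1%:R^-1 = m.+1%:R^-1 *+ c :> rat.
    by rewrite hc natrM invfM -[RHS]mulr_natl mulrA mulfV // mul1r.
  by rewrite (additive_mapMn _ _ (fq k)) (additive_mapMn _ _ psiD) hk.
have [k hk] : exists k, forall n, C n k.
  apply: directed_closed_meet => //.
  - by constructor; exact: 0%N.
  - by move=> n; apply: eval_eq_closed; exact: (fqc _).2.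
  - move=> n; have [|k hk] := @evaluation_surjective n.+1%:R^-1 _ (psi n.+1%:R^-1).
      by rewrite invr_eq0 pnatr_eq0.
    by exists k.
  - move=> n m; exists (n.+1 * m.+1).-1 => k Ck; split.
      by apply: (Cdvd _ _ _ _ Ck); rewrite prednK ?muln_gt0 // dvdn_mulr.
    by apply: (Cdvd _ _ _ _ Ck); rewrite prednK ?muln_gt0 // dvdn_mull.
exists k; exact: rat_additive_eq.
Qed.

(** Closed subgroups with the same image under [f] as [K]; by [dual_surjective] this image is all of
    Hom(Q, T). *)
Let good (L : set K) := [/\ subgroup_set L, closed L &
  forall k, exists2 l, L l & forall q, f l q = f k q].

(** Zorn's lemma for reverse inclusion. The intersection of a chain still covers: the parts of a
    fibre of [f] in the members of the chain are nonempty, closed and nested, so they have a common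
    point. *)
Lemma minimal_covering_subgroup : exists L, good L /\
  forall L', good L' -> L' `<=` L -> L' = L.
Proof.
have goodT : good setT.
  by split; [split|exact: closedT|move=> k; exists k].
pose X := {L : set K | good L}.
pose Rl : rel X := fun A B => `[< sval B `<=` sval A >].
have [|||A totA|[L gL] Lmin] := @Zorn X Rl.
- by move=> A; apply: asboolT.
- by move=> A B C /asboolW AB /asboolW BC; apply: asboolT => x /BC /AB.
- move=> [A gA] [B gB] /asboolW /= AB /asboolW /= BA.
  have E : A = B by rewrite eqEsubset; split.
  by move: gA AB BA; rewrite E => gA _ _; congr exist; exact: Prop_irrelevance.
- have [[A0 hA0]|/forallNP nA] := pselect (exists A0, A A0); last first.
    by exists (exist _ _ goodT) => s /nA.
  pose I := {a : X | A a}.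
  pose M := [set x | forall i : I, sval (sval i) x].
  have gi (i : I) : good (sval (sval i)) := svalP (sval i).
  have gM : good M.
    split.
    + split; first by move=> i; have [[]] := gi i.
      move=> x y Mx My i; have [[_ Lsub] _ _] := gi i.
      by apply: Lsub; [exact: Mx|exact: My].
    + by apply: closed_all => i; have [] := gi i.
    + move=> k.
      pose D (i : I) := [set l | sval (sval i) l /\ forall q, f l q = f k q].
      have [l hl] : exists l, forall i, D i l.
        apply: directed_closed_meet => //.
        * by constructor; exists A0.
        * move=> i; have [_ Lc _] := gi i; apply: closedI => //.
          by apply: closed_all => q; apply: eval_eq_closed; exact: (fqc _).2.
        * by move=> i; have [_ _ /(_ k) [l Ll fl]] := gi i; exists l.
        * move=> [i hi] [j hj]; have [/asboolW /= h|/asboolW /= h] := totA _ _ hi hj.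
            by exists (exist _ _ hj) => l [jl fl]; split; split => //; exact: h.
          by exists (exist _ _ hi) => l [jl fl]; split; split => //; exact: h.
      exists l; first by move=> i; have [] := hl i.
      by have [] := hl (exist _ _ hA0).
  exists (exist _ _ gM) => s hs; apply: asboolT => x /= Mx; exact: (Mx (exist _ _ hs)).
exists L; split => // L' gL' LL'.
by have /(congr1 sval) := Lmin (exist _ _ gL') (asboolT LL').
Qed.

(** * A minimal covering subgroup is a copy of the dual of the rationals *)

Section MinimalSubgroup.
Variable L : set K.
Hypotheses (gL : good L) (Lmin : forall L', good L' -> L' `<=` L -> L' = L).

Let fmulz n l q : f (l *+ n) q = f l q *+ n.
Proof. exact: additive_mapMn (fqc q).1. Qed.

(* [m L] still covers because the dual of the rationals is divisible. *)
Lemma minimal_mulrn n l : L l -> exists2 l', L l' & l = l' *+ n.+1.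
Proof.
have [Ls Lc Lsur] := gL; have [L0 Lsub] := Ls.
pose M := [set x | exists2 l', L l' & x = l' *+ n.+1].
have mulc m : continuous (fun x : K => x *+ m).
  elim: m => [|m IH]; first by move=> x; exact: cvg_cst.
  rewrite (_ : (fun x => _) = (fun x => x + x *+ m)); last by apply/funext => x; rewrite mulrS.
  by apply: addf_continuous => // x; exact: cvg_id.
have LM x m : L x -> L (x *+ m).
  move=> Lx; elim: m => [|m IH]; first by rewrite mulr0n.
  by rewrite mulrS -[x *+ m]opprK; apply: (Lsub) => //; rewrite -sub0r; exact: Lsub.
have gM : good M.
  split.
  - split; first by exists 0; rewrite ?mul0rn.
    move=> _ _ [x Lx ->] [y Ly ->]; exists (x - y); first exact: Lsub.
    by rewrite mulrnBl.
  - rewrite (_ : M = (fun x => x *+ n.+1) @` L); last first.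
      by rewrite eqEsubset; split => x [y Ly E]; exists y.
    apply: compact_closed => //; apply: continuous_compact.
      exact/continuous_subspaceT/mulc.
    exact: subclosed_compact Lc cK _.
  - move=> k; have [|k' hk'] := @dual_surjective (fun q => f k (q / n.+1%:R)).
      by move=> q r; rewrite mulrDl (fq k).
    have [l' Ll' fl'] := Lsur k'; exists (l' *+ n.+1); first by exists l'.
    by move=> q; rewrite fmulz fl' hk'; exact: rat_additive_mulrn (fq k).
have ML : M = L by apply: Lmin => // _ [x Lx ->]; exact: LM.
by move=> Ll; have : M l by rewrite ML.
Qed.

Lemma minimal_kernel_trivial n0 : L n0 -> (forall q, f n0 q = 0) -> n0 = 0.
Proof.
have [Ls Lc Lsur] := gL; have [L0 Lsub] := Ls.
move=> Ln0 fn0; apply: contrapT => n0nz.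
have [chi [cD cc cn0]] := characters_separate_points R cK hK n0nz.
pose N := [set l | L l /\ forall q, f l q = 0].
have Nc : closed N.
  apply: closedI => //; apply: closed_all => q; apply: eval_eq_closed.
  exact: (fqc q).2.
pose H := chi @` N.
have Hs : H 0 /\ forall x y, H x -> H y -> H (x - y).
  split; first by exists 0; [split => // q; exact: additive_map0 (fqc q).1|exact: additive_map0].
  move=> _ _ [x [Lx fx] <-] [y [Ly fy] <-]; exists (x - y); last exact: additive_mapB.
  by split; [exact: Lsub|move=> q; rewrite fqB fx fy subrr].
have Hc : closed H.
  apply: compact_closed; first exact: circle_hausdorff.
  apply: continuous_compact; first exact: continuous_subspaceT.
  exact: subclosed_compact Nc cK _.
have [HT|[d [d0 hd]]] := circle_subgroup_dichotomy Hs Hc.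
  (* If chi maps [N] onto the circle, correcting by elements of [N] shows that the part of [L]
     killed by chi still covers; by minimality it is [L], against chi n0 <> 0. *)
  pose L1 := [set l | L l /\ chi l = 0].
  have gL1 : good L1.
    split.
    - split; first by split => //; exact: additive_map0.
      move=> x y [Lx cx] [Ly cy]; split; first exact: Lsub.
      by rewrite (additive_mapB _ _ cD) cx cy subrr.
    - by apply: closedI => //; apply: eval_eq_closed.
    - move=> k; have [l Ll fl] := Lsur k; have [n [Ln fn] cn] := HT (chi l).
      exists (l - n); last by move=> q; rewrite fqB fn subr0 fl.
      by split; [exact: Lsub|rewrite (additive_mapB _ _ cD) cn subrr].
  have : L1 n0 by rewrite (Lmin gL1) // => x [].
  by case.
have [M M0 hM] := circle_subgroup_exponent Hs d0
  (fun x xd Hx => etrans (congr1 _ (hd x xd Hx)) (@cpi0 R)).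
have [l Ll n0E] := minimal_mulrn M.-1 Ln0; rewrite prednK // in n0E.
apply: cn0; rewrite n0E (additive_mapMn _ _ cD); apply: hM; exists l => //; split => // q.
(* The root l again lies in [N]: f l q is M times f l (q / M), that is, f n0 (q / M) = 0. *)
have := rat_additive_mulrn M.-1 q (fq l); rewrite prednK // -fmulz -n0E fn0.
by move=> <-.
Qed.

Lemma minimal_injective l l' : L l -> L l' -> (forall q, f l q = f l' q) -> l = l'.
Proof.
move=> Ll Ll' ll'; have [[_ Lsub] _ _] := gL.
apply: subr0_eq; apply: minimal_kernel_trivial; first exact: Lsub.
by move=> q; rewrite fqB ll' subrr.
Qed.

(* [f] is a closed embedding of [L], so continuity may be tested after it. *)
Lemma minimal_lift_continuous (X : topologicalType) (h : X -> K) :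
  (forall x, L (h x)) -> (forall q, continuous (fun x => f (h x) q)) -> continuous h.
Proof.
move=> Lh fhc x N hN.
have [_ Lc _] := gL.
have {}fhc : continuous (fun x => f (h x)) by apply: prod_continuous.
pose C := L `&` ~` N°.
have Cc : compact C.
  apply: (subclosed_compact _ cK) => //; apply: closedI => //.
  exact/open_closedC/open_interior.
have : closed (f @` C).
  apply: compact_closed.
    by apply: (@hausdorff_product _ (fun=> T)) => _; exact: circle_hausdorff.
  by apply: continuous_compact => //; exact: continuous_subspaceT.
move=> /closed_openC oC.
have nC : (~` (f @` C)) (f (h x)).
  move=> [l [Ll nl] fl]; apply: nl.
  by rewrite (minimal_injective Ll (Lh x)) // => q; rewrite fl.
have nx : nbhs x [set y | (~` (f @` C)) (f (h y))].
  exact: fhc x _ (open_nbhs_nbhs (conj oC nC)).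
apply: filterS nx => y /= ny; apply: interior_subset; apply: contrapT => nN.
by apply: ny; exists (h y) => //; split.
Qed.

Lemma minimal_section (psi : rat -> T) : additive_map psi ->
  exists2 l, L l & forall q, f l q = psi q.
Proof.
have [_ _ Lsur] := gL; move=> /dual_surjective [k fk]; have [l Ll fl] := Lsur k.
by exists l => // q; rewrite fl.
Qed.

(** [e k] is the point of [L] with the same image as [k], and [b x] the point over the homomorphism
    sending q to qx modulo 1; injectivity of [f] on [L] yields the identities required of them. *)
Lemma minimal_subgroup_not_clipped : ~ clipped R K.
Proof.
have [[L0 Lsub] Lc Lsur] := gL.
have /boolp.choice [e he] : forall k, exists l, L l /\ forall q, f l q = f k q.
  by move=> k; have [l] := Lsur k; exists l.
have /boolp.choice [b hb] : forall x : R, exists l, L l /\ forall q, f l q = cpi (ratr q * x).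
  move=> x; have [|l] := @minimal_section (fun q => cpi (ratr q * x)); last by exists l.
  by move=> q r; rewrite rmorphD mulrDl cpiD.
have Le k := (he k).1; have fe k := (he k).2.
have Lb x := (hb x).1; have fb x := (hb x).2.
have LD x y : L x -> L y -> L (x + y).
  by move=> Lx Ly; rewrite -[y]opprK; apply: (Lsub) => //; rewrite -sub0r; exact: Lsub.
apply: (@idempotent_not_clipped K e _ _ _ R b) => //.
- move=> x y; apply: minimal_injective => //; first exact: LD.
  by move=> q; rewrite fe !fD !fe.
- apply: minimal_lift_continuous => // q; rewrite (_ : (fun x => _) = f^~ q).
    exact: (fqc q).2.
  by apply/funext => x; rewrite fe.
- by move=> x; apply: minimal_injective.
- move=> x y; apply: minimal_injective => //; first exact: LD.
  by move=> q; rewrite fD !fb mulrDr cpiD.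
- apply: minimal_lift_continuous => // q.
  rewrite (_ : (fun x => _) = (fun x : R => cpi (ratr q * x))).
    exact: comp_continuous (@mulrl_continuous R _) (@cpi_continuous R).
  by apply/funext => x; rewrite fb.
- by move=> x; apply: minimal_injective.
move=> g gD gc eg.
have Lg x : L (g x) by rewrite -eg.
have [||c hc] := @circle_hom_linear R (fun x => f (g x) 1).
- by move=> x y; rewrite gD fD.
- exact: comp_continuous gc (fqc 1).2.
exists c; split.
  move=> x; apply: minimal_injective => // q; rewrite fb.
  move: q; apply: rat_additive_eq => //.
    by move=> q r; rewrite rmorphD mulrDl cpiD.
  (* Since [c] is read off at q = 1, the value at 1 / (n + 1) is reached by writing x as n + 1 times
     x / (n + 1). *)
  move=> n; have -> : x = (x / n.+1%:R) *+ n.+1 by rewrite -[RHS]mulr_natr divfK // pnatr_eq0.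
  rewrite (additive_mapMn _ _ gD) fmulz.
  have := rat_additive_mulrn n 1 (fq (g (x / n.+1%:R))); rewrite div1r => ->.
  have rn : ratr (n.+1%:R^-1) = n.+1%:R^-1 :> R by rewrite fmorphV rmorph_nat.
  rewrite hc rn -[X in _ = cpi (_ * (_ * X))]mulr_natr; congr cpi; field.
  by rewrite addrC natr1 pnatr_eq0.
move=> c' hc'; apply: cpi_scale_inj => x.
by rewrite -hc hc' fb rmorph1 mul1r.
Qed.

End MinimalSubgroup.

Lemma rational_solenoid_not_clipped : ~ clipped R K.
Proof.
have [L [gL Lmin]] := minimal_covering_subgroup.
exact: minimal_subgroup_not_clipped gL Lmin.
Qed.

End RationalSolenoid.

Lemma Qdual_not_clipped (R : realType) (K : topologicalZmodType) :
  compact_group K -> connected [set: K] -> ~ cHom_Qdual_trivial R K -> ~ clipped R K.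
Proof.
move=> [cK hK] connK /existsNP [f] /not_implyP [fq] /not_implyP [fD] /not_implyP [fc].
move=> /existsNP [k] /existsNP [q fkq].
exact: (@rational_solenoid_not_clipped R K cK hK connK f fq fD fc k q fkq).
Qed.

(** * Decomposition *)

Section ProductGroup.
Variables G H : topologicalZmodType.

Lemma prod_sub_continuous :
  continuous (fun p : (G * H) * (G * H) => p.1 - p.2).
Proof.
apply: (@pair_continuous _ _ _ (fun p : (G * H) * (G * H) => p.1.1 - p.2.1)
  (fun p : (G * H) * (G * H) => p.1.2 - p.2.2)); apply: subf_continuous.
- exact: comp_continuous (@fst_continuous _ _) (@fst_continuous _ _).
- exact: comp_continuous (@snd_continuous _ _) (@fst_continuous _ _).
- exact: comp_continuous (@fst_continuous _ _) (@snd_continuous _ _).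
- exact: comp_continuous (@snd_continuous _ _) (@snd_continuous _ _).
Qed.

(* The product instance of the library is only declared for topological vector
   spaces and shadows one declared on [G * H], hence the alias. *)
Definition prod_group : Type := (G * H)%type.

HB.instance Definition _ := GRing.Zmodule.copy prod_group (G * H)%type.
HB.instance Definition _ := Topological.copy prod_group (G * H)%type.
HB.instance Definition _ :=
  PreTopologicalNmodule_isTopologicalZmodule.Build prod_group prod_sub_continuous.
End ProductGroup.

(** * Rank of the space of one-parameter subgroups *)

Lemma additive_map_sum (U V : zmodType) (f : U -> V) (I : finType) (F : I -> U) :
  additive_map f -> f (\sum_i F i) = \sum_i f (F i).
Proof.
move=> fD; apply: (big_morph f) => [x y|]; first exact: fD.
exact: additive_map0.
Qed.

(** An upper bound for dim cHom(R, G) without a basis: any n + 1 one-parameter subgroups are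
    linearly dependent over R. In this form it passes directly to a factor. *)
Definition rank_le (R : realType) (G : topologicalZmodType) (n : nat) : Prop :=
  forall g : 'I_n.+1 -> R -> G,
    (forall i, additive_map (g i) /\ continuous (g i)) ->
    exists c : 'I_n.+1 -> R, (exists i, c i != 0) /\
      forall x, \sum_i g i (c i * x) = 0.

(** The matrix of coordinates has n + 1 rows and n columns, so its left kernel is nonzero. *)
Lemma has_dim_rank_le (R : realType) (G : topologicalZmodType) n :
  has_dim R G n -> rank_le R G n.
Proof.
move=> [b [bH bspan]] g gH.
have /boolp.choice [A hA] : forall i, exists a : 'I_n -> R,
    forall x, g i x = \sum_j b j (a j * x).
  by move=> i; have [a [ha _]] := bspan _ (gH i).1 (gH i).2; exists a.
pose M := \matrix_(i, j) A i j.
have : kermx M != 0.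
  rewrite kermx_eq0 /row_free neq_ltn; apply/orP; left.
  by rewrite ltnS rank_leq_col.
move=> /rowV0Pn [v /sub_kermxP vM v0].
exists (fun i => v 0 i); split.
  apply: contrapT => /forallNP h; case/eqP: v0; apply/rowP => i.
  by rewrite mxE; apply/eqP; have /negP := h i; rewrite negbK.
move=> x; under eq_bigr => i _ do rewrite hA.
rewrite exchange_big /= big1 // => j _.
rewrite -(additive_map_sum _ (bH j).1).
have -> : \sum_i A i j * (v 0 i * x) = (v *m M) 0 j * x.
  rewrite mxE mulr_suml; apply: eq_bigr => i _.
  by rewrite mxE; ring.
by rewrite vM mxE mul0r additive_map0 //; exact: (bH j).1.
Qed.

Lemma solenoid_path (R : realType) (S : topologicalZmodType) : solenoid R S ->
  exists b : R -> S, [/\ additive_map b, continuous b &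
    forall c, (forall x, b (c * x) = 0) -> c = 0].
Proof.
move=> [_ [_ [b [bH bspan]]]]; exists (b ord0); split => [||c hc].
- exact: (bH ord0).1.
- exact: (bH ord0).2.
have [||c0 [_ uc]] := bspan (fun=> 0).
- by move=> x y; rewrite addr0.
- by move=> x; exact: cvg_cst.
have E1 : c0 = (fun=> c) by apply: uc => x; rewrite big_ord1 hc.
have E2 : c0 = (fun=> 0).
  by apply: uc => x; rewrite big_ord1 mul0r additive_map0 //; exact: (bH ord0).1.
by have := congr1 (fun h => h ord0) (etrans (esym E1) E2).
Qed.

Lemma top_iso_prod_right (G S L : topologicalZmodType) :
  top_iso_prod G S L -> compact_group G -> connected [set: G] ->
  compact_group L /\ connected [set: L].
Proof.
move=> [f [g [fD [fg [gf [fc gc]]]]]] [cG hG] connG.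
have pc : continuous (fun x => (f x).2) := comp_continuous fc (@snd_continuous _ _).
have ps y : exists x, (f x).2 = y by exists (g (0, y)); rewrite gf.
split; last exact: image_connected_setT pc ps connG.
split; first exact: image_compact_setT pc ps cG.
apply: (@injective_hausdorff _ _ (fun y => g (0, y)) _ _ hG).
  by move=> x y /(congr1 f); rewrite !gf => -[].
apply: comp_continuous gc; apply: pair_continuous => x; first exact: cvg_cst.
exact: cvg_id.
Qed.

(** A nonzero path in [S] joined to m + 1 paths in [L] gives m + 2 paths in [G]. In a relation among
    these the coefficient on [S] vanishes by [solenoid_path], so a nonzero one remains on [L]. For n
    = 0 the path in [S] alone contradicts the bound. *)
Lemma rank_le_factor (R : realType) (G S L : topologicalZmodType) n :
  solenoid R S -> top_iso_prod G S L -> rank_le R G n ->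
  exists2 m, n = m.+1 & rank_le R L m.
Proof.
move=> /solenoid_path [b [bD bc b0]] [f [g [fD [fg [gf [fc gc]]]]]] rG.
have gD : additive_map g.
  by move=> p q; apply: (can_inj fg); rewrite fD !gf.
have inL (h : R -> L) : additive_map h -> continuous h ->
    additive_map (fun x => g (0, h x)) /\ continuous (fun x => g (0, h x)).
  move=> hD hc; split.
    by move=> x y; rewrite hD -gD; congr g; congr (_, _); rewrite addr0.
  by apply: comp_continuous gc; apply: pair_continuous => // x; exact: cvg_cst.
have inS : additive_map (fun x => g (b x, 0)) /\ continuous (fun x => g (b x, 0)).
  split; first by move=> x y; rewrite bD -gD; congr g; congr (_, _); rewrite addr0.
  by apply: comp_continuous gc; apply: pair_continuous => // x; exact: cvg_cst.
case: n rG => [|m] rG.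
  have [c [[i ci] hc]] := rG (fun=> fun x => g (b x, 0)) (fun=> inS).
  case/eqP: ci; rewrite (ord1 i); apply: b0 => x.
  have := hc x; rewrite big_ord1 => /(congr1 f).
  by rewrite gf (additive_map0 fD) => /(congr1 fst).
exists m => // h hh.
pose gg (i : 'I_m.+2) : R -> G :=
  if unlift ord0 i is Some j then fun x => g (0, h j x) else fun x => g (b x, 0).
have [|c [[i ci] hc]] := rG gg.
  move=> i; rewrite /gg; case: unliftP => [j _|_] //.
  exact: inL (hh j).1 (hh j).2.
have E x : f (\sum_i gg i (c i * x)) = (b (c ord0 * x), \sum_j h j (c (lift ord0 j) * x)).
  rewrite big_ord_recl fD /gg unlift_none gf (additive_map_sum _ fD).
  under eq_bigr => j _ do rewrite liftK gf.
  rewrite (_ : \sum_j _ = (0, \sum_j h j (c (lift ord0 j) * x))).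
    by congr (_, _); rewrite ?addr0 ?add0r.
  apply/esym/(@additive_map_sum _ _ (fun y : L => (0, y) : S * L)) => y z.
  by congr (_, _); rewrite addr0.
have {}E x : b (c ord0 * x) = 0 /\ \sum_j h j (c (lift ord0 j) * x) = 0.
  have := E x; rewrite hc (additive_map0 fD) => H.
  by split; [exact: esym (congr1 fst H)|exact: esym (congr1 snd H)].
exists (fun j => c (lift ord0 j)); split; last by move=> x; have [] := E x.
case: (unliftP ord0 i) ci => [j ->|->] ci; first by exists j.
by case/eqP: ci; apply: b0 => x; have [] := E x.
Qed.

(** * Rearranging products and the induction *)

Lemma prod_eval_continuous (I : Type) (T : I -> topologicalType) i :
  continuous (fun h : prod_topology T => h i).
Proof. exact: (@proj_continuous {classic I} T i). Qed.

Lemma totally_factored_prod (R : realType) (S T : topologicalZmodType) :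
  solenoid R S -> totally_factored R T -> compact_group (prod_group S T) ->
  connected [set: prod_group S T] -> totally_factored R (prod_group S T).
Proof.
move=> sS [_ [_ [I [Si [sSi [f [g [fD [fg [gf [fc gc]]]]]]]]]]] cST connST.
split => //; split => //.
pose S' (o : option I) := if o is Some i then Si i else S.
exists (option I), S'; split; first by case.
pose F (p : S * T) : prod_topology S' :=
  fun o => if o is Some i return S' o then f p.2 i else p.1.
pose H (h : prod_topology S') : S * T := (h None, g (fun i => h (Some i))).
exists F, H; split; first by move=> x y [i|] //=; exact: fD.
split; first by move=> [x y]; rewrite /H /F /= -[in RHS](fg y).
split.
  move=> h; rewrite /F /H /=; apply: functional_extensionality_dep => -[i|] //=.
  by rewrite gf.
split.
  apply: prod_continuous => -[i|]; last exact: fst_continuous.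
  exact: (comp_continuous (comp_continuous (@snd_continuous S T) fc)
    (@prod_eval_continuous I Si i)).
apply: pair_continuous; first exact: (@prod_eval_continuous _ S' None).
apply: comp_continuous gc; apply: prod_continuous => i.
exact: (@prod_eval_continuous _ S' (Some i)).
Qed.

Lemma trivial_subgroup (G : topologicalZmodType) : subgroup_set [set x : G | x = 0].
Proof. by split => // x y /= -> ->; rewrite subrr. Qed.

Lemma totally_factored_trivial (R : realType) (G : topologicalZmodType) :
  totally_factored R (subgroup (@trivial_subgroup G)).
Proof.
set T := subgroup _.
have T0 (x y : T) : x = y.
  by apply: val_inj; have /= -> := subgroupP x; have /= -> := subgroupP y.
have TE : [set: T] = [set 0] by rewrite eqEsubset; split => // x _; exact: T0.
split; last split.
- split; first by rewrite TE; exact: compact_set1.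
  by move=> x y _; exact: T0.
- by rewrite TE; exact: connected1.
exists False, (fun=> T); split => //.
pose c : prod_topology (fun _ : False => T) := fun i => match i with end.
exists (fun=> c), (fun=> 0); split => //.
split; first by move=> x; exact: T0.
split; first by move=> h; apply: functional_extensionality_dep => -[].
by split; exact: cst_continuous.
Qed.

Lemma top_iso_prod_trivial (G : topologicalZmodType) :
  top_iso_prod G G (subgroup (@trivial_subgroup G)).
Proof.
exists (fun x => (x, 0)), fst; split.
  by move=> x y; congr (_, _); rewrite addr0.
split => //; split.
  by move=> [x y]; congr (_, _); apply: val_inj; have /= -> := subgroupP y.
split; last exact: fst_continuous.
by apply: pair_continuous => x; [exact: cvg_id|exact: cvg_cst].
Qed.

(** Regroups the factors so that the newly split solenoid joins the totally factored part. *)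
Lemma top_iso_prod_assoc (G S L K T : topologicalZmodType) :
  top_iso_prod G S L -> top_iso_prod L K T -> top_iso_prod G K (prod_group S T).
Proof.
move=> [f [g [fD [fg [gf [fc gc]]]]]] [f' [g' [f'D [f'g' [g'f' [f'c g'c]]]]]].
exists (fun x => ((f' (f x).2).1, ((f x).1, (f' (f x).2).2))).
exists (fun p => g (p.2.1, g' (p.1, p.2.2))).
have c2 : continuous (fun x => f' (f x).2).
  exact: comp_continuous (comp_continuous fc (@snd_continuous _ _)) f'c.
split; first by move=> x y; rewrite fD /= f'D.
split; first by move=> x /=; rewrite -surjective_pairing f'g' -surjective_pairing fg.
split; first by move=> [k [s t]] /=; rewrite gf /= g'f'.
split.
  apply: pair_continuous; first exact: comp_continuous c2 (@fst_continuous _ _).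
  apply: pair_continuous; first exact: comp_continuous fc (@fst_continuous _ _).
  exact: comp_continuous c2 (@snd_continuous _ _).
apply: comp_continuous gc; apply: pair_continuous.
  exact: comp_continuous (@snd_continuous _ _) (@fst_continuous _ _).
apply: comp_continuous g'c; apply: pair_continuous; first exact: fst_continuous.
exact: comp_continuous (@snd_continuous _ _) (@snd_continuous _ _).
Qed.

Lemma top_iso_prod_sym (G K L : topologicalZmodType) :
  top_iso_prod G K L -> top_iso_prod G L K.
Proof.
move=> [f [g [fD [fg [gf [fc gc]]]]]].
exists (fun x => ((f x).2, (f x).1)), (fun p => g (p.2, p.1)); split.
  by move=> x y; rewrite fD.
split; first by move=> x /=; rewrite -surjective_pairing fg.
split; first by move=> [x y]; rewrite /= gf.
split.
  apply: pair_continuous; first exact: comp_continuous fc (@snd_continuous _ _).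
  exact: comp_continuous fc (@fst_continuous _ _).
by apply: comp_continuous gc; apply: pair_continuous; [exact: snd_continuous|exact: fst_continuous].
Qed.

(** Induction on the rank bound, which drops with each solenoid split off; at 0 no solenoid factor
    can exist. *)
Lemma clipped_decomposition (R : realType) n : forall G : topologicalZmodType,
  compact_group G -> connected [set: G] -> rank_le R G n ->
  exists K T : topologicalZmodType,
    [/\ top_iso_prod G K T, totally_factored R T & clipped R K].
Proof.
elim: n => [|n IH] G cG connG rG;
  have [clG|/contrapT [S [L [sS iso]]]] := pselect (clipped R G).
- exists G, (subgroup (@trivial_subgroup G)).
  by split => //; [exact: top_iso_prod_trivial|exact: totally_factored_trivial].
- by have [] := rank_le_factor sS iso rG.
- exists G, (subgroup (@trivial_subgroup G)).
  by split => //; [exact: top_iso_prod_trivial|exact: totally_factored_trivial].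
have [m [<-] rL] := rank_le_factor sS iso rG.
have [cL connL] := top_iso_prod_right iso cG connG.
have [K [T [isoL tfT clK]]] := IH L cL connL rL.
have isoG := top_iso_prod_assoc iso isoL.
have [cST connST] := top_iso_prod_right isoG cG connG.
by exists K, (prod_group S T); split => //; exact: totally_factored_prod.
Qed.

Theorem theorem5p2 (R : realType) (G : topologicalZmodType) :
  compact [set: G] -> hausdorff_space G -> connected [set: G] ->
  (exists n : nat, has_dim R G n) ->
  exists K T : topologicalZmodType,
    top_iso_prod G K T /\ totally_factored R T /\
    compact_group K /\ clipped R K /\
    cHom_circle_trivial R K /\ cHom_Qdual_trivial R K.
Proof.
move=> cG hG connG [n /has_dim_rank_le rG].
have [K [T [iso tfT clK]]] := clipped_decomposition (conj cG hG) connG rG.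
have [cK connK] := top_iso_prod_right (top_iso_prod_sym iso) (conj cG hG) connG.
exists K, T; do 4![split => //]; split; apply: contrapT.
  by move=> /(circle_not_clipped cK connK).
by move=> /(Qdual_not_clipped cK connK).
Qed.
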